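(* Let $(A,\mathfrak m)$ be a Noetherian local ring with infinite residue field and let $I$ be an ideal of $A$ (not necessarily $\mathfrak m$-primary) with $\operatorname{depth}(I,A)=t>0$. Let $x\in I$ be a non-zero divisor of $A$. Then $$\operatorname{type}_I(A)=\operatorname{type}_{I/(x)}\big(A/(x)\big).$$
   Context: $\operatorname{depth}(I,A)$ denotes the grade of $I$ on $A$, i.e. the length of a maximal $A$-regular sequence contained in $I$. For a Noetherian local ring $(B,\mathfrak n)$ and an ideal $L$ of $B$, the generalized type of $B$ with respect to $L$ is $\operatorname{type}_L(B)=\lambda_B\big(\operatorname{Ext}^{s}_B(B/L,B)\big)$, where $s=\operatorname{depth}B$ is the depth of the local ring $B$ and $\lambda_B$ denotes length (possibly infinite). *)

(* Defs.v *)
From HB Require Import structures.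
From mathcomp Require Import all_boot all_order all_algebra.
From mathcomp Require Import finmap all_classical.

Set Implicit Arguments.
Unset Strict Implicit.
Unset Printing Implicit Defensive.

Import GRing.Theory.
Local Open Scope ring_scope.

(* Rings are commutative and possibly zero (comPzRingType), so that the
   quotient by an arbitrary ideal, even the unit ideal, is again a ring.
   Submodules of M are the terms of type submodClosed M; an ideal of R is a
   submodule of R^o. *)
Notation ideal R := (submodClosed R^o).

(* submodClosed does not record closure under opposites, which over a ring
   follows from closure under scaling. *)
Section SubmodZmod.
Variables (R : comPzRingType) (M : lmodType R) (S : submodClosed M).

Definition zmod_of : {pred M} := fun u => u \in S.

Fact zmod_of_closed : zmod_closed zmod_of.
Proof. exact: GRing.submod_closedB (GRing.submodClosedP S). Qed.
HB.instance Definition _ := GRing.isZmodClosed.Build M zmod_of zmod_of_closed.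

End SubmodZmod.

Section Submodule.
Variables (R : comPzRingType) (M : lmodType R) (S : submodClosed M).

Record submodule := Submodule { subval : M; subvalP : subval \in S }.

HB.instance Definition _ := [isSub for subval].
HB.instance Definition _ := [Choice of submodule by <:].
HB.instance Definition _ := [SubChoice_isSubLmodule of submodule by <:].

End Submodule.

Section QuotientModule.
Variables (R : comPzRingType) (M : lmodType R) (S : submodClosed M).

Definition quot_module : Type := Quotient.quot (zmod_of S).

HB.instance Definition _ := GRing.Zmodule.on quot_module.

Definition pi_mod (u : M) : quot_module := \pi_(Quotient.quot (zmod_of S))%qT u.

Lemma pi_modP (u : quot_module) : exists v, u = pi_mod v.
Proof. by exists (repr (u : Quotient.quot (zmod_of S))); rewrite /pi_mod reprK. Qed.

Lemma pi_modD u v : pi_mod (u + v) = pi_mod u + pi_mod v.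
Proof. exact: (raddfD \pi_(Quotient.quot (zmod_of S))%qT). Qed.

Lemma pi_modE u v : (pi_mod u = pi_mod v) <-> (u - v \in S).
Proof.
rewrite -[u - v \in S]/(u - v \in zmod_of S) Quotient.idealrBE.
by split=> [|/eqP//] /eqP.
Qed.

Definition quot_scale (a : R) (u : quot_module) : quot_module :=
  pi_mod (a *: repr (u : Quotient.quot (zmod_of S))).

Lemma pi_modZ a u : pi_mod (a *: u) = quot_scale a (pi_mod u).
Proof.
apply/pi_modE; rewrite -scalerBr rpredZ //; apply/pi_modE.
by rewrite /pi_mod reprK.
Qed.

Fact quot_scaleA a b u : quot_scale a (quot_scale b u) = quot_scale (a * b) u.
Proof. by have [v ->] := pi_modP u; rewrite -!pi_modZ scalerA. Qed.

Fact quot_scale1 : left_id 1 quot_scale.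
Proof. by move=> u; have [v ->] := pi_modP u; rewrite -!pi_modZ scale1r. Qed.

Fact quot_scaleDr : right_distributive quot_scale +%R.
Proof.
move=> a u1 u2; have [v1 ->] := pi_modP u1; have [v2 ->] := pi_modP u2.
by rewrite -pi_modD -!pi_modZ scalerDr pi_modD.
Qed.

Fact quot_scaleDl u : {morph quot_scale^~ u : a b / a + b}.
Proof.
move=> a b; have [v ->] := pi_modP u.
by rewrite -!pi_modZ scalerDl pi_modD.
Qed.

HB.instance Definition _ := GRing.Zmodule_isLmodule.Build R quot_module
  quot_scaleA quot_scale1 quot_scaleDr quot_scaleDl.

Fact pi_mod_is_linear : linear pi_mod.
Proof. by move=> a u v; rewrite pi_modD pi_modZ. Qed.

HB.instance Definition _ :=
  GRing.isLinear.Build R M quot_module _ pi_mod pi_mod_is_linear.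

End QuotientModule.

Section QuotientRing.
Variables (R : comPzRingType) (I : ideal R).

Definition quot_ring : Type := Quotient.quot (zmod_of I).

HB.instance Definition _ := GRing.Zmodule.on quot_ring.

Definition pi_ring (a : R) : quot_ring := \pi_(Quotient.quot (zmod_of I))%qT (a : R^o).

Lemma pi_ringP (u : quot_ring) : exists a, u = pi_ring a.
Proof. by exists (repr (u : Quotient.quot (zmod_of I))); rewrite /pi_ring reprK. Qed.

Lemma pi_ringD a b : pi_ring (a + b) = pi_ring a + pi_ring b.
Proof. exact: (raddfD \pi_(Quotient.quot (zmod_of I))%qT). Qed.

Lemma pi_ringE a b : (pi_ring a = pi_ring b) <-> ((a - b : R^o) \in I).
Proof. exact: (@pi_modE R R^o I a b). Qed.

Definition quot_one : quot_ring := pi_ring 1.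

Definition quot_mul (u v : quot_ring) : quot_ring :=
  pi_ring ((repr (u : Quotient.quot (zmod_of I)) : R) * (repr (v : Quotient.quot (zmod_of I)) : R)).

Lemma pi_ringM a b : pi_ring (a * b) = quot_mul (pi_ring a) (pi_ring b).
Proof.
rewrite /quot_mul; set a' := repr _ : R; set b' := repr _ : R.
have aa' : ((a - a' : R^o) \in I) by apply/pi_ringE; rewrite /pi_ring reprK.
have bb' : ((b - b' : R^o) \in I) by apply/pi_ringE; rewrite /pi_ring reprK.
apply/pi_ringE.
have -> : a * b - a' * b' = b *: (a - a' : R^o) + a' *: (b - b' : R^o) :> R^o.
  by rewrite /GRing.scale /= !mulrBr [b * a]mulrC [b * a']mulrC addrA subrK.
by rewrite rpredD // rpredZ.
Qed.

Fact quot_mulA : associative quot_mul.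
Proof.
move=> u v w; have [a ->] := pi_ringP u; have [b ->] := pi_ringP v.
by have [c ->] := pi_ringP w; rewrite -!pi_ringM mulrA.
Qed.

Fact quot_mulC : commutative quot_mul.
Proof.
move=> u v; have [a ->] := pi_ringP u; have [b ->] := pi_ringP v.
by rewrite -!pi_ringM mulrC.
Qed.

Fact quot_mul1 : left_id quot_one quot_mul.
Proof. by move=> u; have [a ->] := pi_ringP u; rewrite -pi_ringM mul1r. Qed.

Fact quot_mulDl : left_distributive quot_mul +%R.
Proof.
move=> u v w; have [a ->] := pi_ringP u; have [b ->] := pi_ringP v.
by have [c ->] := pi_ringP w; rewrite -pi_ringD -!pi_ringM mulrDl pi_ringD.
Qed.

HB.instance Definition _ := GRing.Zmodule_isComPzRing.Build quot_ring
  quot_mulA quot_mulC quot_mul1 quot_mulDl.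

Fact pi_ring_is_zmod_morphism : zmod_morphism pi_ring.
Proof. exact: (raddfB \pi_(Quotient.quot (zmod_of I))%qT). Qed.

Fact pi_ring_is_monoid_morphism : monoid_morphism pi_ring.
Proof. by split=> // a b; rewrite pi_ringM. Qed.

HB.instance Definition _ :=
  GRing.isZmodMorphism.Build R quot_ring pi_ring pi_ring_is_zmod_morphism.
HB.instance Definition _ :=
  GRing.isMonoidMorphism.Build R quot_ring pi_ring pi_ring_is_monoid_morphism.

End QuotientRing.

Section KernelImage.
Variables (R : comPzRingType) (M N : lmodType R) (f : {linear M -> N}).

Definition lin_ker : {pred M} := fun u => f u == 0.

Fact lin_ker_closed : submod_closed lin_ker.
Proof.
split=> [|a u v]; rewrite !unfold_in ?linear0 // => /eqP fu /eqP fv.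
by rewrite linearP fu fv scaler0 addr0.
Qed.
HB.instance Definition _ :=
  GRing.isSubmodClosed.Build R M lin_ker lin_ker_closed.

Definition lin_im : {pred N} := fun v => `[< exists u, f u = v >].

Fact lin_im_closed : submod_closed lin_im.
Proof.
split=> [|a u v]; first by apply/asboolP; exists 0; rewrite linear0.
move=> /asboolP[u' <-] /asboolP[v' <-]; apply/asboolP.
by exists (a *: u' + v'); rewrite linearP.
Qed.
HB.instance Definition _ :=
  GRing.isSubmodClosed.Build R N lin_im lin_im_closed.

End KernelImage.

Section Hom.
Variables (R : comPzRingType) (M N : lmodType R).

Definition linear_pred : {pred M -> N} := fun f => `[< linear f >].

Fact linear_pred_closed : submod_closed linear_pred.
Proof.
split=> [|a f g]; rewrite !unfold_in.
  by apply/asboolP=> b u v; rewrite scaler0 addr0.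
move=> /asboolP lf /asboolP lg; apply/asboolP=> b u v.
rewrite -[LHS]/(a *: f (b *: u + v) + g (b *: u + v)).
rewrite -[RHS]/(b *: (a *: f u + g u) + (a *: f v + g v)).
by rewrite lf lg !scalerDr !scalerA [a * b]mulrC addrACA.
Qed.
HB.instance Definition _ :=
  GRing.isSubmodClosed.Build R (M -> N) linear_pred linear_pred_closed.

Definition Hom := submodule linear_pred.
HB.instance Definition _ := SubType.on Hom.
HB.instance Definition _ := GRing.Lmodule.on Hom.

Lemma Hom_linear (f : Hom) : linear (val f).
Proof. exact/asboolP/(valP f). Qed.

End Hom.

Arguments linear_pred {R} M N.

Section Precomposition.
Variables (R : comPzRingType) (L M N : lmodType R) (d : {linear L -> M}).

Fact precomp_subproof (f : Hom M N) : val f \o d \in linear_pred L N.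
Proof. by apply/asboolP=> a u v /=; rewrite linearP (Hom_linear f). Qed.

Definition precomp (f : Hom M N) : Hom L N := Submodule (precomp_subproof f).

Fact precomp_is_linear : linear precomp.
Proof. by move=> a f g; apply/val_inj. Qed.
HB.instance Definition _ :=
  GRing.isLinear.Build R (Hom M N) (Hom L N) _ precomp precomp_is_linear.

End Precomposition.

Section ProjectiveResolution.
Variable R : comPzRingType.

Definition projective (P : lmodType R) : Prop :=
  forall (M N : lmodType R) (g : {linear M -> N}) (f : {linear P -> N}),
    (forall v, exists u, g u = v) ->
    exists h : {linear P -> M}, forall p, g (h p) = f p.

Record proj_resolution (M : lmodType R) := ProjResolution {
  res_mod :> nat -> lmodType R;
  res_diff : forall n, {linear res_mod n.+1 -> res_mod n};
  res_aug : {linear res_mod 0 -> M};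
  res_proj : forall n, projective (res_mod n);
  res_aug_surj : forall u, exists p, res_aug p = u;
  res_exact0 : forall p, res_aug p = 0 <-> exists q, res_diff 0 q = p;
  res_exactS : forall n p,
    res_diff n p = 0 <-> exists q, res_diff n.+1 q = p
}.

End ProjectiveResolution.

Section FreeModule.
Variables (R : comPzRingType) (X : choiceType).

Definition finsupp_pred : {pred X -> R^o} :=
  fun c => `[< finite_set [set x | c x != 0] >].

Fact finsupp_closed : submod_closed finsupp_pred.
Proof.
split=> [|a f g]; rewrite !unfold_in.
  apply/asboolP; apply: (sub_finite_set (B := set0)) => // x /=.
  by rewrite eqxx.
move=> /asboolP ff /asboolP fg; apply/asboolP.
apply: (sub_finite_set (B := [set x | f x != 0] `|` [set x | g x != 0])) => [x|].
  rewrite /= -[_ x]/(a *: f x + g x).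
  have [->|] := eqVneq (f x) 0; last by left.
  by rewrite scaler0 add0r; right.
by rewrite finite_setU.
Qed.
HB.instance Definition _ :=
  GRing.isSubmodClosed.Build R (X -> R^o) finsupp_pred finsupp_closed.

Definition free_module := submodule finsupp_pred.
HB.instance Definition _ := SubType.on free_module.
HB.instance Definition _ := GRing.Lmodule.on free_module.

Implicit Types (c : free_module) (x y : X).

Definition coef c x : R^o := val c x.

Definition support c : {fset X} := fset_set [set x | coef c x != 0].

Lemma supportP c x : (x \in support c) = (coef c x != 0).
Proof.
rewrite /support in_fset_set ?inE //; last exact/asboolP/(valP c).
by apply/asboolP/idP.
Qed.

Fact free_basis_subproof x : (fun y => (x == y)%:R) \in finsupp_pred.
Proof.
apply/asboolP; apply: (sub_finite_set (B := [set x])) => [y|] //=.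
by have [->|_] := eqVneq x y; rewrite ?eqxx.
Qed.

Definition free_basis x : free_module := Submodule (free_basis_subproof x).

Section Lift.
Variables (M : lmodType R) (g : X -> M).

Definition free_lift c : M := \sum_(x <- support c) coef c x *: g x.

Lemma free_liftE (D : {fset X}) c : {subset support c <= D} ->
  free_lift c = \sum_(x <- D) coef c x *: g x.
Proof.
move=> /fsubsetP sD; apply: big_fset_incl => // x _.
by rewrite supportP negbK => /eqP ->; rewrite scale0r.
Qed.

Fact free_lift_is_linear : linear free_lift.
Proof.
move=> a c1 c2; pose D := (support c1 `|` support c2)%fset.
have coefE x : coef (a *: c1 + c2) x = a *: coef c1 x + coef c2 x by [].
rewrite (@free_liftE D c1) ?(@free_liftE D c2) ?(@free_liftE D (_ + _)).
- rewrite scaler_sumr -big_split; apply: eq_bigr => x _ /=.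
  by rewrite coefE scalerDl scalerA.
- move=> x; rewrite !inE !supportP coefE.
  have [->|//] := eqVneq (coef c1 x) 0.
  by rewrite scaler0 add0r.
- by move=> x xc; rewrite inE xc orbT.
- by move=> x xc; rewrite inE xc.
Qed.
HB.instance Definition _ :=
  GRing.isLinear.Build R free_module M _ free_lift free_lift_is_linear.

Lemma free_lift_basis x : free_lift (free_basis x) = g x.
Proof.
rewrite (@free_liftE [fset x]%fset) => [|y].
  by rewrite big_seq_fset1 /coef /= eqxx scale1r.
by rewrite supportP inE /coef /=; case: (eqVneq x y); rewrite ?eqxx.
Qed.

End Lift.

Lemma free_expand c : c = free_lift free_basis c.
Proof.
apply/val_inj/funext => x; rewrite /free_lift.
have valE (D : {fset X}) : val (\sum_(y <- D) coef c y *: free_basis y) x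
    = \sum_(y <- D) coef c y * (y == x)%:R.
  by elim/big_rec2: _ => // y u v _ <-.
rewrite valE; have [xc|] := boolP (x \in support c).
  rewrite (big_fsetD1 x) //= eqxx mulr1 big_seq big1 ?addr0 // => y.
  by rewrite !inE => /andP[/negPf -> _]; rewrite mulr0.
move=> xc; have /eqP cx : coef c x == 0 by rewrite -[_ == _]negbK -supportP.
rewrite -[LHS]/(coef c x) cx big_seq big1 // => y yc.
by have [yx|_] := eqVneq y x; [rewrite -yx yc in xc | rewrite mulr0].
Qed.

Lemma free_projective : projective free_module.
Proof.
move=> M N g f /choice[s gs].
pose h : {linear free_module -> M} := free_lift (fun x => s (f (free_basis x))).
exists h => c; rewrite [in RHS](free_expand c) /h /= /free_lift !linear_sum.
by apply: eq_bigr => x _; rewrite !linearZ /= gs.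
Qed.

End FreeModule.

Section StandardResolution.
Variables (R : comPzRingType) (M : lmodType R).

Definition cover (N : lmodType R) : {linear free_module R N -> N} :=
  free_lift (id : N -> N).

Fixpoint syzygy n : lmodType R :=
  if n is n'.+1 then submodule (lin_ker (cover (syzygy n'))) else M.

Definition std_mod n : lmodType R := free_module R (syzygy n).

Definition std_diff n : {linear std_mod n.+1 -> std_mod n} :=
  (val : submodule (lin_ker (cover (syzygy n))) -> _) \o cover (syzygy n.+1).

Lemma cover_surj (N : lmodType R) (u : N) : exists p, cover N p = u.
Proof. by exists (free_basis R u); rewrite /cover /= free_lift_basis. Qed.

Lemma std_exact n p : cover (syzygy n) p = 0 <-> exists q, std_diff n q = p.
Proof.
split=> [p0 | [q <-]]; last exact/eqP/(valP (cover (syzygy n.+1) q)).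
have pK : p \in lin_ker (cover (syzygy n)) by apply/eqP.
have [q qp] := @cover_surj (syzygy n.+1) (Submodule pK).
by exists q; rewrite /std_diff /= qp.
Qed.

Lemma std_diff0 n p : std_diff n p = 0 <-> cover (syzygy n.+1) p = 0.
Proof.
split=> [p0|p0]; first exact/val_inj.
by rewrite /std_diff /= p0.
Qed.

(* Each term is the free module on the underlying set of the previous
   syzygy. *)
Definition std_resolution : proj_resolution M.
Proof.
apply: (@ProjResolution _ _ std_mod std_diff (cover M)).
- by move=> n; apply: free_projective.
- exact: cover_surj.
- exact: (@std_exact 0).
- by move=> n p; rewrite std_diff0; apply: std_exact.
Defined.

End StandardResolution.

Section Ext.
Variables (R : comPzRingType) (M N : lmodType R) (P : proj_resolution M).

Definition cobound n : {linear Hom (P n) N -> Hom (P n.+1) N} :=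
  @precomp R (P n.+1) (P n) N (res_diff P n).

Definition cocycle n : lmodType R := submodule (lin_ker (cobound n)).

Definition coboundary n : {pred cocycle n} :=
  match n with
  | 0 => fun z => z == 0
  | n'.+1 => fun z => val z \in lin_im (cobound n')
  end.

Fact coboundary_closed n : submod_closed (@coboundary n).
Proof.
case: n => [|n]; split=> [|a u v]; rewrite ?unfold_in /coboundary /=.
- by [].
- by move=> /eqP -> /eqP ->; rewrite scaler0 addr0.
- exact: (rpred0 (lin_im (cobound n))).
- exact: (GRing.submodClosedP (lin_im (cobound n))).2.
Qed.
HB.instance Definition _ n :=
  GRing.isSubmodClosed.Build R (cocycle n) (@coboundary n)
    (@coboundary_closed n).

Definition Ext_of n : lmodType R := quot_module (@coboundary n).

End Ext.

(* The n-th cohomology of Hom(P, N) for the standard free resolution P of M;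
   up to isomorphism it does not depend on the projective resolution. *)
Definition Ext (R : comPzRingType) (n : nat) (M N : lmodType R) : lmodType R :=
  Ext_of N (std_resolution M) n.

Definition has_chain (R : comPzRingType) (M : lmodType R) (n : nat) : Prop :=
  exists S : nat -> submodClosed M, forall i, (i < n)%N ->
    {subset S i <= S i.+1} /\ ~ {subset S i.+1 <= S i}.

(* The largest length of a strict chain of submodules, None meaning infinity. *)
Definition length (R : comPzRingType) (M : lmodType R) : option nat :=
  xget None [set Some n | n in
    [set n | has_chain M n /\ ~ has_chain M n.+1]]%classic.

Section Ideals.
Variable R : comPzRingType.

Definition span_ideal (s : seq R) : {pred R^o} :=
  fun a => `[< exists c : nat -> R, a = \sum_(i < size s) c i * s`_i >].

Fact span_ideal_closed s : submod_closed (span_ideal s).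
Proof.
split=> [|a u v]; rewrite !unfold_in.
  by apply/asboolP; exists (fun=> 0); rewrite big1 // => i _; rewrite mul0r.
move=> /asboolP[c ->] /asboolP[d ->]; apply/asboolP.
exists (fun i => a * c i + d i).
rewrite -[_ *: _]/(a * _) mulr_sumr -big_split; apply: eq_bigr => i _ /=.
by rewrite mulrDl mulrA.
Qed.
HB.instance Definition _ s :=
  GRing.isSubmodClosed.Build R R^o (span_ideal s) (span_ideal_closed s).

Definition noetherian : Prop :=
  forall J : ideal R, exists s, J =i span_ideal s.

Definition maximal_ideal (J : ideal R) : Prop :=
  1 \notin J /\
  forall K : ideal R, {subset J <= K} -> 1 \notin K -> {subset K <= J}.

Definition local_ring (m : ideal R) : Prop :=
  maximal_ideal m /\ forall J : ideal R, maximal_ideal J -> J =i m.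

(* s = [:: r_0; ...; r_(n-1)] is R-regular: R / (s) is nonzero and each r_i is
   a nonzerodivisor on R / (r_0, ..., r_(i-1)). *)
Definition regular_seq (s : seq R) : Prop :=
  1 \notin span_ideal s /\
  forall i, (i < size s)%N ->
    GRing.lreg (pi_ring (span_ideal (take i s)) s`_i).

Definition max_regular_seq (I : ideal R) (s : seq R) : Prop :=
  [/\ regular_seq s, {subset s <= I} &
      forall y, y \in I -> ~ regular_seq (rcons s y)].

(* Over a noetherian local ring all maximal regular sequences in I have the
   same length, so the choice made by xget is immaterial. *)
Definition depth (I : ideal R) : nat :=
  xget 0%N [set size s | s in max_regular_seq I]%classic.

(* The generalized type with respect to L of the local ring R with maximal
   ideal n. *)
Definition gen_type (n L : ideal R) : option nat :=
  length (Ext (depth n) (quot_module L) R^o).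

End Ideals.

Section IdealImage.
Variables (R : comPzRingType) (J I : ideal R).

(* The image of I in R / J, that is (I + J) / J. *)
Definition quot_ideal : {pred (quot_ring J)^o} :=
  fun u => `[< exists2 a, a \in I & pi_ring J a = u >].

Fact quot_ideal_closed : submod_closed quot_ideal.
Proof.
split=> [|b u v]; rewrite !unfold_in.
  by apply/asboolP; exists 0; rewrite ?rpred0 ?raddf0.
move=> /asboolP[u' Iu <-] /asboolP[v' Iv <-]; apply/asboolP.
have [a ->] := pi_ringP b.
exists (a * u' + v'); last by rewrite rmorphD rmorphM.
exact: (GRing.submodClosedP I).2 a u' v' Iu Iv.
Qed.
HB.instance Definition _ :=
  GRing.isSubmodClosed.Build (quot_ring J) (quot_ring J)^o quot_ideal
    quot_ideal_closed.

End IdealImage.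

Arguments quot_ideal {R} J I.

(* Main.v *)
(** Put B = A/(x). The key is Rees' isomorphism
    Ext^(n+1)_A(A/I, A) = Ext^n_B(B/IB, B), valid for every ideal I containing
    the regular element x. To see it, lift a free B-resolution F of N = B/IB to
    free A-modules G_n with maps d : G_(n+1) -> G_n. Then d d = x h for some h,
    and T_n = G_n + G_(n-1) with D(u, v) = (d u + x v, - h u - d v) is an
    A-resolution of N. A cochain (f, g) on T_(n+1) is a cocycle iff
    g d = x f, so it is determined by g, and g -> (g mod x) identifies the
    cohomology of Hom_A(T, A) in degree n+1 with that of Hom_B(F, B) in
    degree n.

    By induction on s, for s a maximal regular sequence in a proper ideal m,
    Ext^i_A(A/m, A) is zero for i < size s and nonzero for i = size s; the case
    s = [::] holds because in a noetherian ring an ideal of zero divisors is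
    killed by one nonzero element. Hence depth does not depend on the
    chosen sequence and depth A = depth B + 1. If I is the unit ideal, then all
    the Ext modules vanish. *)
Require Import Defs.
From HB Require Import structures.
From mathcomp Require Import all_boot all_order all_algebra.
From mathcomp Require Import finmap all_classical.
Import GRing.Theory.
Local Open Scope ring_scope.

Set Implicit Arguments.
Unset Strict Implicit.
Unset Printing Implicit Defensive.

(** The types [T n] vary with [n], as for the terms of a chain map; [inv] makes the next choice
    possible and [rel] ties it to the previous one. *)
Lemma dependent_choice (T : nat -> Type) (inv : forall n, T n -> Prop)
    (rel : forall n, T n -> T n.+1 -> Prop) (x0 : T 0) :
  inv 0 x0 ->
  (forall n x, inv n x -> exists y, inv n.+1 y /\ rel n x y) ->
  exists f : forall n, T n,
    f 0 = x0 /\ forall n, inv n (f n) /\ rel n (f n) (f n.+1).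
Proof.
move=> inv0 step.
pose next n (s : {x | inv n x}) := cid (step n (sval s) (svalP s)).
pose g := fix g n : {x | inv n x} :=
  if n is n'.+1 then exist _ (sval (next n' (g n'))) (svalP (next n' (g n'))).1
  else exist _ x0 inv0.
exists (fun n => sval (g n)); split=> // n.
by split; [exact: (svalP (g n)) | exact: (svalP (next n (g n))).2].
Qed.

(** * Isomorphisms along a ring map, and length *)

Section Semilinear.
Variables (A B : comPzRingType) (phi : {rmorphism A -> B}).

Definition linear_along (V : lmodType A) (W : lmodType B) (f : V -> W) : Prop :=
  forall a u v, f (a *: u + v) = phi a *: f u + f v.

(** Compares modules over different rings; for [phi = idfun] it is ordinary isomorphism. *)
Definition semi_iso (V : lmodType A) (W : lmodType B) : Prop :=
  exists f : V -> W,
    [/\ linear_along f, injective f & forall w, exists v, f v = w].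

Section Theory.
Variables (V : lmodType A) (W : lmodType B) (f : V -> W).
Hypothesis fl : linear_along f.

Lemma linear_alongD u v : f (u + v) = f u + f v.
Proof. by have := fl 1 u v; rewrite scale1r rmorph1 scale1r. Qed.

Lemma linear_along0 : f 0 = 0.
Proof. by apply: (addrI (f 0)); rewrite -linear_alongD !addr0. Qed.

Lemma linear_alongZ a u : f (a *: u) = phi a *: f u.
Proof. by have := fl a u 0; rewrite !addr0 linear_along0 addr0. Qed.

Lemma linear_alongN u : f (- u) = - f u.
Proof. by apply: (addrI (f u)); rewrite -linear_alongD !subrr linear_along0. Qed.

Lemma linear_alongB u v : f (u - v) = f u - f v.
Proof. by rewrite linear_alongD linear_alongN. Qed.

Lemma linear_along_sum (I : Type) (r : seq I) (F : I -> V) :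
  f (\sum_(i <- r) F i) = \sum_(i <- r) f (F i).
Proof. exact: (big_morph f linear_alongD linear_along0). Qed.

End Theory.

(** The first isomorphism theorem along [phi]. *)
Lemma quot_semi_iso (V : lmodType A) (W : lmodType B) (S : submodClosed V)
    (f : V -> W) :
  linear_along f -> (forall w, exists v, f v = w) ->
  (forall v, f v = 0 <-> v \in S) -> semi_iso (quot_module S) W.
Proof.
move=> fl fs fK.
have [g gE] : exists g : quot_module S -> W, forall v, g (pi_mod S v) = f v.
  have /choice[r rE] : forall u, exists v, u = pi_mod S v by exact: pi_modP.
  exists (f \o r) => v /=; apply/eqP; rewrite -subr_eq0 -linear_alongB //.
  by apply/eqP/fK/pi_modE; rewrite -rE.
exists g; split=> [a u v|u v|w].
- have [u' ->] := pi_modP u; have [v' ->] := pi_modP v.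
  by rewrite -linearP !gE fl.
- have [u' ->] := pi_modP u; have [v' ->] := pi_modP v.
  rewrite !gE => uv; apply/pi_modE/fK.
  by rewrite linear_alongB // uv subrr.
- by have [v <-] := fs w; exists (pi_mod S v); rewrite gE.
Qed.

Hypothesis phi_surj : forall b, exists a, phi a = b.

Section LengthTransfer.
Variables (V : lmodType A) (W : lmodType B) (f : V -> W).
Hypotheses (fl : linear_along f) (fi : injective f).
Hypothesis fs : forall w, exists v, f v = w.

Definition semi_preim (S : submodClosed W) : {pred V} := fun v => f v \in S.

Lemma mem_semi_preim S v : (v \in semi_preim S) = (f v \in S).
Proof. by []. Qed.

Fact semi_preim_closed S : submod_closed (semi_preim S).
Proof.
split=> [|a u v]; rewrite !mem_semi_preim ?linear_along0 ?rpred0 // => uS vS.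
by rewrite fl rpredD ?rpredZ.
Qed.
HB.instance Definition _ S :=
  GRing.isSubmodClosed.Build A V (semi_preim S) (semi_preim_closed S).

Definition semi_im (S : submodClosed V) : {pred W} :=
  fun w => `[< exists2 v, v \in S & f v = w >].

Fact semi_im_closed S : submod_closed (semi_im S).
Proof.
split=> [|b u v].
  by apply/asboolP; exists 0; rewrite ?rpred0 ?linear_along0.
move=> /asboolP[u' uS <-] /asboolP[v' vS <-]; apply/asboolP.
have [a <-] := phi_surj b.
by exists (a *: u' + v'); rewrite ?fl // rpredD ?rpredZ.
Qed.
HB.instance Definition _ S :=
  GRing.isSubmodClosed.Build B W (semi_im S) (semi_im_closed S).

Lemma mem_semi_im S v : (f v \in semi_im S) = (v \in S).
Proof.
by apply/asboolP/idP => [[v' v'S /fi <-]|vS] //; exists v.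
Qed.

(** Since [phi] is onto, the image of an [A]-submodule is a [B]-submodule, so strict chains transfer
    both ways by image and preimage. *)
Lemma has_chain_semi n : has_chain V n <-> has_chain W n.
Proof.
split=> -[S Sn].
  exists (fun i => semi_im (S i) : submodClosed W) => i /Sn[sub nsub]; split=> [w|sub'].
    by have [v <-] := fs w; rewrite !mem_semi_im; apply: sub.
  by apply: nsub => v; rewrite -!(mem_semi_im (S _)); apply: sub'.
exists (fun i => semi_preim (S i) : submodClosed V) => i /Sn[sub nsub]; split=> [v|sub'].
  by rewrite !mem_semi_preim; apply: sub.
apply: nsub => w; have [v <-] := fs w.
exact: (sub' v).
Qed.

End LengthTransfer.

Lemma length_semi_iso (V : lmodType A) (W : lmodType B) :
  semi_iso V W -> length V = length W.
Proof.
move=> [f [fl fi fs]]; rewrite /length.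
suff -> : has_chain V = has_chain W by [].
by apply/funext => n; apply/propext; apply: (has_chain_semi fl).
Qed.

End Semilinear.

Lemma semi_iso_trans (A B : comPzRingType) (phi : {rmorphism A -> B})
    (U V : lmodType A) (W : lmodType B) :
  semi_iso idfun U V -> semi_iso phi V W -> semi_iso phi U W.
Proof.
move=> [f [fl fi fs]] [g [gl gi gs]]; exists (g \o f); split.
- by move=> a u v /=; rewrite fl gl.
- exact: inj_comp.
- by move=> w; have [v <-] := gs w; have [u <-] := fs v; exists u.
Qed.

(** * Comparison of projective resolutions *)

Section Comparison.
Variable R : comPzRingType.

Definition linear_of (M N : lmodType R) (f : M -> N) (fl : linear f) :
    {linear M -> N} :=
  HB.pack f (GRing.isLinear.Build _ _ _ _ f fl).

(** [projective] lifts only along surjections, so both maps are first corestricted to the image of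
    [g]. *)
Lemma projective_lift (P M N : lmodType R) (g : {linear M -> N})
    (f : {linear P -> N}) :
  projective P -> (forall p, exists u, g u = f p) ->
  exists h : {linear P -> M}, forall p, g (h p) = f p.
Proof.
move=> projP gf.
have mk : forall u, g u \in lin_im g by move=> u; apply/asboolP; exists u.
have mf : forall p, f p \in lin_im g by move=> p; apply/asboolP.
pose g' u : submodule (lin_im g) := Submodule (mk u).
pose f' p : submodule (lin_im g) := Submodule (mf p).
have gl : linear g' by move=> a u v; apply/val_inj; rewrite /= linearP.
have fl : linear f' by move=> a u v; apply/val_inj; rewrite /= linearP.
have [v|h hP] := projP _ _ (linear_of gl) (linear_of fl).
  have /asboolP[u uv] := valP v; exists u.
  by apply/val_inj.
by exists h => p; have := congr1 val (hP p).
Qed.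

Variables M N : lmodType R.
Implicit Types P Q : proj_resolution M.

Definition chain_map P Q (f : forall n, {linear P n -> Q n}) : Prop :=
  forall n p, res_diff Q n (f n.+1 p) = f n (res_diff P n p).

Lemma res_diff_comp P n p : res_diff P n (res_diff P n.+1 p) = 0.
Proof. by apply/res_exactS; exists p. Qed.

Lemma res_aug_diff P p : res_aug P (res_diff P 0 p) = 0.
Proof. by apply/res_exact0; exists p. Qed.

Lemma chain_map_exists P Q :
  exists2 f : forall n, {linear P n -> Q n}, chain_map f &
    forall p, res_aug Q (f 0 p) = res_aug P p.
Proof.
have [f0 f0P] := projective_lift (g := res_aug Q) (f := res_aug P)
  (@res_proj _ _ P 0) (fun p => res_aug_surj Q _).
(* The invariant says that [f] carries boundaries to boundaries, so [f] after the differential lifts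
   to the next degree. *)
pose inv n (f : {linear P n -> Q n}) :=
  forall p, exists q, res_diff Q n q = f (res_diff P n p).
pose rel n (f : {linear P n -> Q n}) (f' : {linear P n.+1 -> Q n.+1}) :=
  forall p, res_diff Q n (f' p) = f (res_diff P n p).
have [p|n f fP|f [fE fP]] := dependent_choice (inv := inv) (rel := rel) (x0 := f0).
- by apply/res_exact0; rewrite f0P res_aug_diff.
- have [f' f'P] := projective_lift (g := res_diff Q n)
    (f := f \o res_diff P n) (@res_proj _ _ P n.+1) fP.
  exists f'; split=> // p; apply/res_exactS.
  by rewrite f'P /= res_diff_comp linear0.
- by exists f => [n p|p]; [exact: (fP n).2 | rewrite fE].
Qed.

Lemma null_homotopy P Q (f : forall n, {linear P n -> Q n}) :
  chain_map f -> (forall p, res_aug Q (f 0 p) = 0) ->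
  exists s : forall n, {linear P n -> Q n.+1},
    (forall p, f 0 p = res_diff Q 0 (s 0 p)) /\
    forall n p, f n.+1 p = res_diff Q n.+1 (s n.+1 p) + s n (res_diff P n p).
Proof.
move=> fC f0.
have f0P p : exists q, res_diff Q 0 q = f 0 p by apply/res_exact0.
have [s0 s0P] := projective_lift (@res_proj _ _ P 0) f0P.
(* The invariant makes [f - s d] land in cycles, hence in boundaries, where it lifts to the next
   term of the homotopy. *)
pose inv n (s : {linear P n -> Q n.+1}) :=
  forall p, res_diff Q n (f n.+1 p - s (res_diff P n p)) = 0.
pose rel n (s : {linear P n -> Q n.+1}) (s' : {linear P n.+1 -> Q n.+2}) :=
  forall p, res_diff Q n.+1 (s' p) = f n.+1 p - s (res_diff P n p).
have [p|n s sP|s [sE sP]] := dependent_choice (inv := inv) (rel := rel) (x0 := s0).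
- by rewrite linearB s0P fC subrr.
- have [|s' s'P] := projective_lift (g := res_diff Q n.+1)
    (f := f n.+1 \- (s \o res_diff P n)) (@res_proj _ _ P n.+1).
    by move=> p; apply/res_exactS; apply: sP.
  exists s'; split=> // p.
  by rewrite linearB s'P fC /= res_diff_comp linear0 subr0 subrr.
- exists s; split=> [p|n p]; first by rewrite sE s0P.
  by have [_ ->] := sP n; rewrite subrK.
Qed.

Definition cocycle_fun P n (z : cocycle N P n) : P n -> N := val (val z).

Lemma cocycle_linear P n (z : cocycle N P n) : linear (cocycle_fun z).
Proof. exact: Hom_linear. Qed.

Lemma cocycle_diff P n (z : cocycle N P n) p : cocycle_fun z (res_diff P n p) = 0.
Proof.
have /eqP zK := valP z.
by have := congr1 (fun h => val h p) zK.
Qed.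

Lemma cocycle_funI P n (z w : cocycle N P n) :
  cocycle_fun z =1 cocycle_fun w -> z = w.
Proof. by move=> zw; do 2!apply/val_inj; apply/funext. Qed.

Lemma cocycle_exists P n (f : P n -> N) :
  linear f -> (forall p, f (res_diff P n p) = 0) ->
  exists z : cocycle N P n, cocycle_fun z = f.
Proof.
move=> fl fd.
have fP : f \in linear_pred (P n) N by apply/asboolP.
have zP : Submodule fP \in lin_ker (cobound N P n).
  by apply/eqP/val_inj/funext.
by exists (Submodule zP).
Qed.

Lemma coboundary0P P (z : cocycle N P 0) :
  z \in coboundary (n := 0) <-> forall p, cocycle_fun z p = 0.
Proof.
split=> [/eqP -> //|z0]; apply/eqP; exact/cocycle_funI.
Qed.

Lemma coboundarySP P n (z : cocycle N P n.+1) :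
  z \in coboundary (n := n.+1) <->
  exists2 f : P n -> N, linear f & forall p, cocycle_fun z p = f (res_diff P n p).
Proof.
split=> [/asboolP[f fz]|[f fl fz]].
  by exists (val f) => [|p]; [exact: Hom_linear | rewrite /cocycle_fun -fz].
have fP : f \in linear_pred (P n) N by apply/asboolP.
apply/asboolP; exists (Submodule fP).
by apply/val_inj/funext => p /=; rewrite -fz.
Qed.

End Comparison.

Lemma pi_mod_eq0 (R : comPzRingType) (M : lmodType R) (S : submodClosed M) v :
  pi_mod S v = 0 <-> v \in S.
Proof. by rewrite -(raddf0 (pi_mod S)) pi_modE subr0. Qed.

Section ExtComparison.
Variables (R : comPzRingType) (M N : lmodType R).
Implicit Types P Q : proj_resolution M.

Lemma cocycle_funD P n a (z w : cocycle N P n) p :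
  cocycle_fun (a *: z + w) p = a *: cocycle_fun z p + cocycle_fun w p.
Proof. by []. Qed.

(** Let [s] be a null-homotopy of [f]. A cocycle [z] kills boundaries, so [z f = z s d] is the
    coboundary of [z s]; in degree 0, [z f = z d s = 0]. *)
Lemma null_homotopic_coboundary P n (f : forall n, {linear P n -> P n})
    (z w : cocycle N P n) :
  chain_map f -> (forall p, res_aug P (f 0 p) = 0) ->
  (forall p, cocycle_fun w p = cocycle_fun z (f n p)) -> w \in coboundary (n := n).
Proof.
move=> fC f0; have [s [s0 sS]] := null_homotopy fC f0.
case: n z w => [|n] z w wz.
  by apply/coboundary0P => p; rewrite wz s0 cocycle_diff.
apply/coboundarySP; exists (cocycle_fun z \o s n).
  by move=> a u v /=; rewrite linearP cocycle_linear.
move=> p; rewrite wz sS.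
have /= := linear_alongD (phi := idfun) (cocycle_linear z) => ->.
by rewrite cocycle_diff add0r.
Qed.

(** On a resolution of the zero module the identity has zero augmentation, hence is
    null-homotopic. *)
Lemma Ext_of_zero P n (e : Ext_of N P n) : (forall u : M, u = 0) -> e = 0.
Proof.
move=> M0; have [z ->] := pi_modP e.
apply/pi_mod_eq0.
exact: (null_homotopic_coboundary (f := fun n => idfun : {linear P n -> P n}) (z := z)).
Qed.

Lemma Ext_of_semi_iso P Q n : semi_iso idfun (Ext_of N Q n) (Ext_of N P n).
Proof.
have [f fC f0] := chain_map_exists P Q.
have [g gC g0] := chain_map_exists Q P.
have pull (P' Q' : proj_resolution M) (h : forall n, {linear P' n -> Q' n}) :
    chain_map h -> forall z : cocycle N Q' n, exists w : cocycle N P' n,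
      forall p, cocycle_fun w p = cocycle_fun z (h n p).
  move=> hC z; have [|p|w wE] := @cocycle_exists _ _ N P' n (cocycle_fun z \o h n).
  - by move=> a u v /=; rewrite linearP cocycle_linear.
  - by rewrite /= -hC cocycle_diff.
  - by exists w => p; rewrite wE.
have homotopic (P' Q' : proj_resolution M) (h : forall n, {linear P' n -> Q' n})
    (k : forall n, {linear Q' n -> P' n}) (z w : cocycle N P' n) :
    chain_map h -> (forall p, res_aug Q' (h 0 p) = res_aug P' p) ->
    chain_map k -> (forall p, res_aug P' (k 0 p) = res_aug Q' p) ->
    (forall p, cocycle_fun w p = cocycle_fun z (k n (h n p))) ->
    z - w \in coboundary (n := n).
  move=> hC h0 kC k0 wE.
  (* The chain map [id - k h] has zero augmentation, hence is null-homotopic. *)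
  apply: (null_homotopic_coboundary (z := z)
    (f := fun n => idfun \- (k n \o h n) : {linear P' n -> P' n})) => [i p|p|p] /=.
  - by rewrite linearB kC hC.
  - by rewrite linearB k0 h0 subrr.
  - have /= -> := linear_alongB (phi := idfun) (cocycle_linear z).
    by rewrite -wE.
have cobE (P' Q' : proj_resolution M) (h : forall n, {linear P' n -> Q' n})
    (z : cocycle N Q' n) (w : cocycle N P' n) :
    chain_map h -> (forall p, cocycle_fun w p = cocycle_fun z (h n p)) ->
    z \in coboundary (n := n) -> w \in coboundary (n := n).
  move=> hC; move: z w; case: (n) => [|n'] z w wz.
    by move=> /coboundary0P z0; apply/coboundary0P => p; rewrite wz z0.
  move=> /coboundarySP[k kl kz]; apply/coboundarySP; exists (k \o h n').
    by move=> a u v /=; rewrite linearP kl.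
  by move=> p; rewrite wz kz hC.
have /choice[F FE] := pull _ _ _ fC.
apply: (quot_semi_iso (f := fun z => pi_mod (coboundary (n := n)) (F z))).
- move=> a u v; rewrite -linearP; congr (pi_mod _ _).
  apply/cocycle_funI => p.
  by rewrite FE !cocycle_funD !FE.
- move=> w; have [z ->] := pi_modP w.
  have [y yE] := pull _ _ _ gC z; exists y; apply/esym/pi_modE.
  by apply: (homotopic _ _ f g) => // p; rewrite FE yE.
- move=> z; split=> [/pi_mod_eq0 FB|zB].
    have [y yE] := pull _ _ _ gC (F z).
    (* [y] is [z] pulled back along [f g]: it differs from [z] by a coboundary, and is one because
       [F z] is. *)
    rewrite -(subrK y z) rpredD //; last exact: (cobE _ _ g (F z)).
    by apply: (homotopic _ _ g f) => // p; rewrite yE FE.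
  by apply/pi_mod_eq0; apply: (cobE _ _ f z).
Qed.

End ExtComparison.

(** * Rees' isomorphism *)

Lemma projective_prod (R : comPzRingType) (P Q : lmodType R) :
  projective P -> projective Q -> projective (P * Q)%type.
Proof.
move=> projP projQ M N g f gs.
have f1l : linear (fun p => f (p, 0)).
  by move=> a u v; rewrite -linearP; congr (f (_, _)); rewrite /= scaler0 addr0.
have f2l : linear (fun q => f (0, q)).
  by move=> a u v; rewrite -linearP; congr (f (_, _)); rewrite /= scaler0 addr0.
have [h1 h1P] := projP _ _ g (linear_of f1l) gs.
have [h2 h2P] := projQ _ _ g (linear_of f2l) gs.
have hl : linear (fun u : P * Q => h1 u.1 + h2 u.2).
  by move=> a u v; rewrite /= !linearP scalerDr addrACA.
exists (linear_of hl) => -[p q]; rewrite /= linearD h1P h2P /= -linearD.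
by congr (f (_, _)); rewrite /= ?addr0 ?add0r.
Qed.

(** * Reduction modulo a regular element *)

Section Reduction.
Variables (A B : comPzRingType) (phi : {rmorphism A -> B}) (x : A).
Hypotheses (phi_surj : forall b, exists a, phi a = b) (phi_x : phi x = 0).
Hypothesis phi_ker : forall a, phi a = 0 -> exists b, a = x * b.
Hypothesis x_reg : GRing.lreg x.

(** Expresses that [f] identifies [W] with [V / x V] and that [x] is regular on [V]. No quotient is
    formed, so it applies directly to coefficientwise reduction of free modules. *)
Definition reduction (V : lmodType A) (W : lmodType B) (f : V -> W) : Prop :=
  [/\ linear_along phi f, forall w, exists v, f v = w,
      forall v, f v = 0 -> exists w, v = x *: w & injective (fun v : V => x *: v)].

Lemma reduction_x (V : lmodType A) (W : lmodType B) (f : V -> W) v :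
  linear_along phi f -> f (x *: v) = 0.
Proof. by move=> fl; rewrite (linear_alongZ fl) phi_x scale0r. Qed.

Lemma reduction_eq (V : lmodType A) (W : lmodType B) (f : V -> W) u v :
  reduction f -> f u = f v -> exists w, u = v + x *: w.
Proof.
move=> [fl _ fK _] uv; have [|w uvE] := fK (u - v).
  by rewrite (linear_alongB fl) uv subrr.
by exists w; rewrite -uvE addrC subrK.
Qed.

Lemma reduction_ring : @reduction A^o B^o phi.
Proof. by split=> // a u v; rewrite rmorphD rmorphM. Qed.

Lemma divide_linear (U V : lmodType A) (f : U -> V) :
  injective (fun v : V => x *: v) -> linear f ->
  (forall u, exists v, f u = x *: v) ->
  exists g : {linear U -> V}, forall u, f u = x *: g u.
Proof.
move=> xi fl /choice[g gE].
have gl : linear g.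
  move=> a u v; apply: xi; rewrite /= -gE fl !gE.
  by rewrite scalerDr !scalerA mulrC.
by exists (linear_of gl).
Qed.

(** [g] maps [x V] into [x V'], so it passes to the reductions; [d] is computed on chosen
    preimages. *)
Lemma reduction_descend (V V' : lmodType A) (W W' : lmodType B)
    (r : V -> W) (r' : V' -> W') (g : V -> V') :
  reduction r -> reduction r' -> linear g ->
  exists2 d : W -> W', linear d & forall v, d (r v) = r' (g v).
Proof.
move=> rr [rl' _ _ _] gl; have [rl rs rK _] := rr.
have /choice[s sE] := rs.
have dE v : r' (g (s (r v))) = r' (g v).
  have [w ->] := reduction_eq rr (sE (r v)).
  have gl' : linear_along idfun g := gl.
  rewrite (linear_alongD gl') (linear_alongD rl') (linear_alongZ gl').
  by rewrite (reduction_x _ rl') addr0.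
exists (r' \o g \o s) => [b u v|v] /=; last exact: dE.
have [a <-] := phi_surj b; rewrite -{1}(sE u) -{1}(sE v) -rl dE gl rl'.
by [].
Qed.

Section FreeReduction.
Variable X : choiceType.

Fact free_red_subproof (c : free_module A X) :
  (fun y => phi (coef c y) : B^o) \in @finsupp_pred B X.
Proof.
apply/asboolP; apply: (sub_finite_set (B := [set y | coef c y != 0])) => [y|].
  by apply: contra => /eqP ->; rewrite rmorph0.
exact/asboolP/(valP c).
Qed.

Definition free_red c : free_module B X := Submodule (free_red_subproof c).

Lemma free_red_basis y : free_red (free_basis A y) = free_basis B y.
Proof. by apply/val_inj/funext => z; rewrite /coef /= rmorph_nat. Qed.

Lemma free_exists (R : comPzRingType) (c : X -> R) (D : set X) :
  finite_set D -> (forall y, c y != 0 -> D y) ->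
  exists c' : free_module R X, forall y, coef c' y = c y.
Proof.
move=> fD cD; have cP : (c : X -> R^o) \in @finsupp_pred R X.
  by apply/asboolP; apply: sub_finite_set fD => y; apply: cD.
by exists (Submodule cP).
Qed.

Lemma free_module_ext (R : comPzRingType) (c c' : free_module R X) :
  coef c =1 coef c' -> c = c'.
Proof. by move=> cc'; apply/val_inj/funext. Qed.

Lemma free_support_finite (R : comPzRingType) (c : free_module R X) :
  finite_set [set y | coef c y != 0].
Proof. exact/asboolP/(valP c). Qed.

Lemma coefZ (R : comPzRingType) (a : R) (c : free_module R X) y :
  coef (a *: c) y = a * coef c y.
Proof. by []. Qed.

Lemma free_reduction : reduction free_red.
Proof.
split=> [a u v|c|c c0|c c' cc'].
- by apply/free_module_ext => y; rewrite /coef /= rmorphD rmorphM.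
(* Zero is lifted to zero, so that the lifted coefficients keep finite support. *)
- have /choice[r rE] : forall b, exists a, phi a = b /\ (b = 0 -> a = 0).
    move=> b; have [->|b0] := eqVneq b 0; first by exists 0; rewrite rmorph0.
    by have [a ab] := phi_surj b; exists a; split=> // bE; rewrite bE eqxx in b0.
  have [|c' c'E] := @free_exists A (fun y => r (coef c y)) _ (free_support_finite c).
    by move=> y; apply: contra => /eqP /(rE _).2 ->.
  exists c'; apply/free_module_ext => y.
  by rewrite -[LHS]/(phi (coef c' y)) c'E (rE _).1.
- have /choice[k kE] : forall y, exists b, coef c y = x * b.
    by move=> y; apply: phi_ker; have := congr1 (fun c => coef c y) c0.
  (* Regularity of [x] makes [k] vanish wherever the coefficient of [c] does, so its support is
     finite. *)
  have [|c' c'E] := @free_exists A k _ (free_support_finite c).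
    move=> y; apply: contra; rewrite kE => /eqP xk; apply/eqP/x_reg.
    by rewrite xk mulr0.
  by exists c'; apply/free_module_ext => y; rewrite kE coefZ c'E.
- apply/free_module_ext => y; apply: x_reg.
  by rewrite -!coefZ; apply: (congr1 (fun c => coef c y) cc').
Qed.

Lemma free_linear_along_ext (W : lmodType B) (f g : free_module A X -> W) :
  linear_along phi f -> linear_along phi g ->
  (forall y, f (free_basis A y) = g (free_basis A y)) -> f =1 g.
Proof.
move=> fl gl fg c; rewrite (free_expand c) /free_lift.
rewrite (linear_along_sum fl) (linear_along_sum gl); apply: eq_bigr => y _.
by rewrite (linear_alongZ fl) (linear_alongZ gl) fg.
Qed.

(** By freeness it suffices to lift the values on basis vectors through [r]. *)
Lemma free_reduction_lift (V : lmodType A) (W : lmodType B) (r : V -> W)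
    (d : free_module B X -> W) :
  reduction r -> linear d ->
  exists g : {linear free_module A X -> V}, forall c, r (g c) = d (free_red c).
Proof.
move=> [rl rs _ _] dl; have [fl _ _ _] := free_reduction.
have /choice[s sE] : forall y, exists v, r v = d (free_basis B y) by [].
exists (free_lift s); apply: free_linear_along_ext.
- by move=> a u v; rewrite linearP rl.
- by move=> a u v; rewrite fl dl.
- by move=> y; rewrite /= free_lift_basis free_red_basis sE.
Qed.

End FreeReduction.
End Reduction.

(** * An [A]-resolution from a [B]-resolution, and its cohomology *)

Section Rees.
Variables (A B : comPzRingType) (phi : {rmorphism A -> B}) (x : A).
Hypotheses (phi_surj : forall b, exists a, phi a = b) (phi_x : phi x = 0).
Hypothesis phi_ker : forall a, phi a = 0 -> exists b, a = x * b.
Hypothesis x_reg : GRing.lreg x.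
Variables (N : lmodType A) (N' : lmodType B) (tau : N -> N').
Hypotheses (tau_lin : linear_along phi tau) (tau_inj : injective tau).
Hypothesis tau_surj : forall u, exists v, tau v = u.

Local Notation F := (std_resolution N').

(** The basis is that of the free [B]-module [F n], so [G n] reduces to [F n] modulo [x]. *)
Definition lifted_mod n : lmodType A := free_module A (syzygy N' n).
Local Notation G := lifted_mod.

Definition lifted_red n : G n -> F n := @free_red _ _ phi (syzygy N' n).
Local Notation rho := lifted_red.

Lemma lifted_redP n : reduction phi x (@rho n).
Proof. exact: free_reduction. Qed.

Let rho_lin n : linear_along phi (@rho n). Proof. by case: (lifted_redP n). Qed.

Lemma lifted_diff_exists : exists D : forall n, {linear G n.+1 -> G n},
  forall n u, rho (D n u) = res_diff F n (rho u).
Proof.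
have lift n : exists D : {linear G n.+1 -> G n},
    forall u, rho (D u) = res_diff F n (rho u).
  have dl : linear (res_diff F n) by exact: linearP.
  have [g gE] := free_reduction_lift phi_surj phi_ker x_reg (lifted_redP n) dl.
  by exists g.
by exists (fun n => sval (cid (lift n))) => n u; case: cid.
Qed.

Section Totalization.
Variable D : forall n, {linear G n.+1 -> G n}.
Hypothesis rhoD : forall n u, rho (D n u) = res_diff F n (rho u).

(** Modulo [x] the composite [D D] becomes that of two differentials of [F], which is zero. *)
Lemma lifted_diff_sq_exists : exists h : forall n, {linear G n.+2 -> G n},
  forall n u, D n (D n.+1 u) = x *: h n u.
Proof.
have div n : exists h : {linear G n.+2 -> G n},
    forall u, D n (D n.+1 u) = x *: h u.
  have [_ _ rK xi] := lifted_redP n.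
  have dl : linear (D n \o D n.+1) by exact: linearP.
  apply: (divide_linear xi dl) => u; apply: rK.
  by rewrite /= !rhoD res_diff_comp.
by exists (fun n => sval (cid (div n))) => n u; case: cid.
Qed.

Variable h : forall n, {linear G n.+2 -> G n}.
Hypothesis DD : forall n u, D n (D n.+1 u) = x *: h n u.

(** Multiplied by [x], both sides equal [D D D u]. *)
Lemma lifted_diff_sqC n u : h n (D n.+2 u) = D n (h n.+1 u).
Proof.
have [_ _ _ xi] := lifted_redP n; apply: xi.
by rewrite /= -DD (@DD n.+1) linearZ.
Qed.

(** Modulo [x], [u] is a cycle of [F], hence a boundary; lifting gives [w] and [y], and cancelling
    [x] then determines [v]. *)
Lemma lifted_exact n (u : G n.+1) (v : G n) : D n u + x *: v = 0 ->
  exists w y, u = D n.+1 w + x *: y /\ v = - h n w - D n y.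
Proof.
move=> uv0; have [rl _ _ xi] := lifted_redP n.
have [_ rs _ _] := lifted_redP n.+2.
have du0 : res_diff F n (rho u) = 0.
  have := congr1 (@rho n) uv0.
  rewrite (linear_alongD rl) (reduction_x phi_x _ rl) addr0 rhoD => ->.
  exact: linear_along0.
have [q qE] := (@res_exactS _ _ F n (rho u)).1 du0.
have [w wq] := rs q; rewrite -wq -rhoD in qE.
have [y uE] := reduction_eq (lifted_redP n.+1) (esym qE).
exists w, y; split=> //; apply: xi => /=; apply: (addrI (D n u)).
by rewrite uv0 uE linearD linearZ /= DD scalerBr scalerN addrACA !subrr addr0.
Qed.

(* The degree 0 term is [G 0] alone, as if [G (-1) = 0]. *)
Definition tot_mod n : lmodType A :=
  if n is k.+1 then (G k.+1 * G k)%type else G 0.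

(** The cone of multiplication by [x] on [G], twisted by [- h] because [D] squares to [x h] and not
    to zero. *)
Definition tot_diff_fun n : tot_mod n.+1 -> tot_mod n :=
  match n return tot_mod n.+1 -> tot_mod n with
  | 0 => fun p => D 0 p.1 + x *: p.2
  | k.+1 => fun p => (D k.+1 p.1 + x *: p.2, - h k p.1 - D k p.2)
  end.

Fact tot_diff_linear n : linear (@tot_diff_fun n).
Proof.
have lin1 k : linear (fun p : G k.+1 * G k => D k p.1 + x *: p.2).
  move=> a p q; rewrite /= linearP !scalerDr !scalerA [x * a]mulrC.
  by rewrite addrACA.
have lin2 k : linear (fun p : G k.+2 * G k.+1 => - h k p.1 - D k p.2).
  have eq2 (V : lmodType A) a (b c b' c' : V) :
      - (a *: b + b') - (a *: c + c') = a *: (- b - c) + (- b' - c').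
    by rewrite !opprD addrACA scalerDr !scalerN.
  move=> a [p1 p2] [q1 q2].
  rewrite -[LHS]/(- h k (a *: p1 + q1) - D k (a *: p2 + q2)).
  by rewrite (linearP (h k)) (linearP (D k)) eq2.
case: n => [|n]; first exact: lin1.
by move=> a p q; congr pair; [apply: lin1 | apply: lin2].
Qed.

Definition tot_diff n : {linear tot_mod n.+1 -> tot_mod n} :=
  linear_of (@tot_diff_linear n).

Lemma tot_aug_exists : exists e : {linear G 0 -> N},
  forall u, tau (e u) = res_aug F (rho u).
Proof.
have /choice[s sE] := tau_surj.
have el : linear (fun u => s (res_aug F (@rho 0 u))).
  move=> a u v; apply: tau_inj.
  by rewrite tau_lin !sE rho_lin linearP.
by exists (linear_of el) => u; rewrite /= sE.
Qed.

Lemma tot_mod_projective n : projective (tot_mod n).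
Proof.
by case: n => [|n]; [|apply: projective_prod]; apply: free_projective.
Qed.

Lemma tot_diff_comp n u : tot_diff n (tot_diff n.+1 u) = 0.
Proof.
have first_eq k (w : G k.+2) (y : G k.+1) :
    D k (D k.+1 w + x *: y) + x *: (- h k w - D k y) = 0.
  by rewrite linearD linearZ /= DD scalerBr scalerN addrACA !subrr addr0.
(* The terms cancel in pairs by [h D = D h] and [D D = x h]. *)
have second_eq k (w : G k.+3) (y : G k.+2) :
    - h k (D k.+2 w + x *: y) - D k (- h k.+1 w - D k.+1 y) = 0.
  have cancel (V : zmodType) (a b : V) : - (a + b) - (- a - b) = 0.
    by rewrite opprB opprK [b + a]addrC addNr.
  rewrite linearD linearZ /= lifted_diff_sqC linearB linearN /= DD.
  exact: cancel.
case: n u => [|n] [w y]; first exact: first_eq.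
by congr pair; [apply: first_eq | apply: second_eq].
Qed.

(** The equation, or its first component in positive degree, is the hypothesis of [lifted_exact],
    whose [w] and [y] form the preimage. *)
Lemma tot_exact n u : tot_diff n u = 0 -> exists v, tot_diff n.+1 v = u.
Proof.
case: n u => [|n] [u v] uv0.
  have [w [y [uE vE]]] := @lifted_exact 0 u v uv0.
  by exists (w, y); rewrite uE vE.
have [w [y [uE vE]]] := @lifted_exact n.+1 u v (congr1 fst uv0).
by exists (w, y); rewrite uE vE.
Qed.

Variable e : {linear G 0 -> N}.
Hypothesis eE : forall u, tau (e u) = res_aug F (rho u).

Lemma tot_aug_eq0 u : e u = 0 <-> res_aug F (rho u) = 0.
Proof.
by rewrite -eE; split=> [->|eu]; [|apply: tau_inj]; rewrite (linear_along0 tau_lin).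
Qed.

Definition tot_resolution : proj_resolution N.
Proof.
apply: (@ProjResolution _ _ tot_mod tot_diff e).
- exact: tot_mod_projective.
- move=> v; have [q qE] := res_aug_surj F (tau v).
  have [_ rs _ _] := lifted_redP 0; have [u uE] := rs q.
  by exists u; apply: tau_inj; rewrite eE uE.
- move=> p; split=> [/tot_aug_eq0/res_exact0[q qE]|[[u v] <-]].
    (* [q] lifts to [u], and [p - D u] is a multiple of [x], which the second summand of
       [tot_diff 0] provides. *)
    have [_ rs _ _] := lifted_redP 1; have [u uE] := rs q.
    rewrite -uE -rhoD in qE.
    have [v pE] := reduction_eq (lifted_redP 0) (esym qE).
    by exists (u, v); rewrite pE.
  apply/tot_aug_eq0; have -> : rho (tot_diff 0 (u, v)) = res_diff F 0 (rho u).
    rewrite -[tot_diff 0 _]/(D 0 u + x *: v) (linear_alongD (@rho_lin 0)).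
    by rewrite (reduction_x phi_x _ (@rho_lin 0)) addr0 rhoD.
  exact: res_aug_diff.
- by move=> n p; split=> [/tot_exact|[q <-]]; last exact: tot_diff_comp.
Defined.

Local Notation T := tot_resolution.
Local Notation A' := (A^o : lmodType A).
Local Notation B' := (B^o : lmodType B).

Lemma tot_cocycle_split n (z : cocycle A' T n.+1) u v :
  cocycle_fun z (u, v) = cocycle_fun z (u, 0) + cocycle_fun z (0, v).
Proof.
rewrite -(linear_alongD (phi := idfun) (cocycle_linear z)); congr (cocycle_fun z _).
by congr pair; rewrite ?addr0 ?add0r.
Qed.

(** Comes from evaluating [z] on the boundary of [(0, - u)]. For [z = (f, g)] it is the relation
    [g D = x f], by which [g] determines [f]. *)
Lemma tot_cocycle_divides n (z : cocycle A' T n.+1) (u : G n.+1) :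
  cocycle_fun z (0, D n u) = x * cocycle_fun z (u, 0).
Proof.
have zl := cocycle_linear z : linear_along idfun (cocycle_fun z).
have dE : tot_diff n.+1 (0, - u) = (- (x *: u), D n u).
  congr pair; first by rewrite linear0 add0r scalerN.
  by rewrite linear0 linearN opprK oppr0 add0r.
have : cocycle_fun z ((- (x *: u), 0) : tot_mod n.+1) + cocycle_fun z (0, D n u) = 0.
  rewrite -tot_cocycle_split -dE.
  exact: cocycle_diff.
have -> : ((- (x *: u), 0) : tot_mod n.+1) = - (x *: ((u, 0) : tot_mod n.+1)).
  by congr pair; rewrite /= scaler0 oppr0.
rewrite (linear_alongN zl) (linear_alongZ zl) => /eqP.
by rewrite addrC subr_eq0 => /eqP.
Qed.

(** The other cocycle condition, [f D = g h], holds after multiplication by [x], since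
    [x f D = g D D = x g h]. *)
Lemma tot_cocycle_exists n (f : {linear G n.+1 -> A'}) (g : {linear G n -> A'}) :
  (forall u, g (D n u) = x * f u) ->
  exists z : cocycle A' T n.+1, forall u v, cocycle_fun z (u, v) = f u + g v.
Proof.
move=> gf.
have zl : linear (fun p : tot_mod n.+1 => f p.1 + g p.2).
  by move=> a p q; rewrite /= !linearP scalerDr addrACA.
have [|z zE] := @cocycle_exists _ _ A' T n.+1 _ zl; last by exists z => u v; rewrite zE.
move=> [u v]; rewrite /= !linearD linearZ !linearN /= gf.
rewrite -[_ *: f v]/(x * f v) addrACA subrr addr0; apply: x_reg.
rewrite mulr0 mulrBr -gf DD linearZ.
exact: subrr.
Qed.

Lemma ring_reduction : reduction phi x (phi : A' -> B').
Proof. exact: reduction_ring. Qed.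

Definition second n (z : cocycle A' T n.+1) (v : G n) : A' := cocycle_fun z (0, v).

Lemma second_linear n (z : cocycle A' T n.+1) : linear (second z).
Proof.
move=> a u v; rewrite /second -(cocycle_linear z); congr (cocycle_fun z _).
by congr pair; rewrite /= scaler0 addr0.
Qed.

Definition corresponds n (z : cocycle A' T n.+1) (c : cocycle B' F n) : Prop :=
  forall v, cocycle_fun c (rho v) = phi (second z v).

(** [g D = x f] vanishes modulo [x], so the reduction of [g] is a cocycle on [F]. *)
Lemma corresponds_right n (z : cocycle A' T n.+1) : exists c, corresponds z c.
Proof.
have [d dl dE] := reduction_descend phi_surj phi_x (lifted_redP n) ring_reduction
  (second_linear z).
have [|c cE] := cocycle_exists dl; last by exists c => v; rewrite cE dE.
move=> p; have [_ rs _ _] := lifted_redP n.+1; have [u <-] := rs p.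
by rewrite -rhoD dE /second tot_cocycle_divides rmorphM /= phi_x mul0r.
Qed.

(** Lift [c] to [g] on [G n]. As [g D] vanishes modulo [x], it is [x f] for some [f], and [(f, g)]
    is a cocycle. *)
Lemma corresponds_left n (c : cocycle B' F n) : exists z, corresponds z c.
Proof.
have [g gE] := free_reduction_lift phi_surj phi_ker x_reg ring_reduction
  (d := cocycle_fun c) (cocycle_linear c).
have [_ _ xK xi] := ring_reduction.
have gl : linear (g \o D n) by exact: linearP.
have [u|f fE] := divide_linear xi gl.
  apply: xK; rewrite /= gE.
  by rewrite -[free_red _ _]/(rho (D n u)) rhoD cocycle_diff.
have [z zE] := tot_cocycle_exists fE.
by exists z => v; rewrite /second zE linear0 add0r gE.
Qed.

Lemma corresponds_coboundary n (z : cocycle A' T n.+1) (c : cocycle B' F n) :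
  corresponds z c ->
  c \in coboundary (n := n) <-> z \in coboundary (n := n.+1).
Proof.
have [_ _ xK xi] := ring_reduction.
have xi' (a b : A') : x *: a = x *: b -> a = b by apply: xi.
move=> zc; split; last first.
  case: n z c zc => [|n] z c zc /coboundarySP[f fl fz].
    (* In degree 0 the only coboundary on [F] is zero, and [second z = x f] does vanish modulo
       [x]. *)
    apply/coboundary0P => p; have [_ rs _ _] := lifted_redP 0.
    have [v <-] := rs p; rewrite zc /second fz.
    rewrite -[res_diff T 0 _]/(D 0 0 + x *: v) linear0 add0r.
    by rewrite (linear_alongZ (phi := idfun) fl) rmorphM phi_x mul0r.
  (* The boundary of [(0, v)] is [(x v, - D v)], so [c] is the coboundary of the reduction of minus
     the second component of [f]. *)
  have f0l : linear (fun v => - f ((0, v) : tot_mod n.+1)).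
    move=> a u v; rewrite scalerN -opprD -fl; congr (- f _).
    by congr pair; rewrite /= scaler0 addr0.
  have [d dl dE] := reduction_descend phi_surj phi_x (lifted_redP n)
    ring_reduction f0l.
  apply/coboundarySP; exists d => // p; have [_ rs _ _] := lifted_redP n.+1.
  have [v <-] := rs p; rewrite zc -rhoD dE /second fz.
  have -> : res_diff T n.+1 ((0, v) : tot_mod n.+2)
      = x *: ((v, 0) : tot_mod n.+1) - ((0, D n v) : tot_mod n.+1).
    rewrite -[LHS]/((D n.+1 0 + x *: v, - h n 0 - D n v) : tot_mod n.+1).
    rewrite -[RHS]/((x *: v - 0, x *: 0 - D n v) : tot_mod n.+1).
    by rewrite !linear0 ?oppr0 ?addr0 ?add0r.
  have fl' : linear_along idfun f := fl.
  rewrite (linear_alongB fl') (linear_alongZ fl') rmorphB rmorphM /= phi_x.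
  by rewrite mul0r add0r rmorphN.
case: n z c zc => [|n] z c zc.
  move=> /coboundary0P c0.
  (* Here [second z = x f], and [z] is the coboundary of [f]; on [(u, 0)] this is checked after
     multiplication by [x]. *)
  have [v|f fE] := divide_linear xi (second_linear z).
    by apply: xK; rewrite -zc c0.
  apply/coboundarySP; exists f => [|[u v]]; first exact: linearP.
  rewrite -[res_diff T 0 _]/(D 0 u + x *: v) linearD linearZ tot_cocycle_split.
  congr (_ + _); last exact: fE.
  by apply: xi'; rewrite -[LHS]tot_cocycle_divides; apply: fE.
move=> /coboundarySP[d dl dE].
(* For [g] a lift of [d], [second z - g D = x f], and [z] is the coboundary of [(f, - g)]. *)
have [g gE] := free_reduction_lift phi_surj phi_ker x_reg ring_reduction (d := d) dl.
have kl : linear (fun v => second z v - g (D n v)).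
  by move=> a u v; rewrite /= second_linear !linearP /= scalerDr addrACA.
have [v|f fE] := divide_linear xi kl.
  apply: xK; rewrite rmorphB -zc dE -rhoD /= gE.
  exact: subrr.
have wl : linear (fun p : tot_mod n.+1 => f p.1 - g p.2).
  by move=> a p q; rewrite /= !linearP /= scalerDr addrACA.
apply/coboundarySP; exists (linear_of wl) => [|[u v]]; first exact: linearP.
have zv w : second z w = x * f w + g (D n w).
  by rewrite -[x * f w]fE subrK.
rewrite -[RHS]/(f (D n.+1 u + x *: v) - g (- h n u - D n v)).
rewrite tot_cocycle_split -[cocycle_fun z (0, v)]/(second z v) zv.
rewrite linearD linearZ linearB linearN opprB opprK.
have zu : cocycle_fun z (u, 0) = f (D n.+1 u) + g (h n u).
  apply: xi'; rewrite -[LHS]tot_cocycle_divides -[LHS]/(second z (D n.+1 u)) zv.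
  by rewrite DD linearZ scalerDr.
by rewrite zu addrACA [g (h n u) + _]addrC.
Qed.

Lemma tot_Ext_semi_iso n : semi_iso phi (Ext_of A' T n.+1) (Ext_of B' F n).
Proof.
have [_ rs _ _] := lifted_redP n.
have uniq (z z' : cocycle A' T n.+1) c c' : corresponds z c -> corresponds z' c' ->
    second z =1 second z' -> c = c'.
  move=> zc zc' zz'; apply: cocycle_funI => p; have [v <-] := rs p.
  by rewrite zc zc' zz'.
have /choice[F_ FE] := @corresponds_right n.
apply: (quot_semi_iso (f := fun z => pi_mod (coboundary (n := n)) (F_ z))).
- move=> a u v; rewrite -linearP; congr (pi_mod _ _).
  apply: (uniq (a *: u + v) (a *: u + v)) => // w.
  rewrite cocycle_funD !FE /second cocycle_funD rmorphD rmorphM.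
  by [].
- move=> w; have [c ->] := pi_modP w; have [z zc] := corresponds_left c.
  by exists z; congr (pi_mod _ _); apply: (uniq z z).
- move=> z; rewrite -(corresponds_coboundary (FE z)); exact: pi_mod_eq0.
Qed.

End Totalization.

Lemma rees n : semi_iso phi (Ext n.+1 N A^o) (Ext n N' B^o).
Proof.
have [D DE] := lifted_diff_exists; have [h hE] := lifted_diff_sq_exists DE.
have [e eE] := tot_aug_exists.
(* [Ext] uses the standard resolution, so it is first transferred to [tot_resolution]. *)
apply: semi_iso_trans (tot_Ext_semi_iso DE hE eE n).
exact: Ext_of_semi_iso.
Qed.

End Rees.

(** * Ideals of zero divisors in noetherian rings *)

Section Noetherian.
Variable R : comPzRingType.

Definition ideal_of (S : {pred R^o}) (Scl : submod_closed S) : ideal R :=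
  HB.pack S (GRing.isSubmodClosed.Build R R^o S Scl).

Lemma mem_span_ideal (s : seq R) y : y \in s -> y \in span_ideal s.
Proof.
move=> ys; apply/asboolP; exists (fun i => (i == index y s)%:R).
rewrite -index_mem in ys; rewrite (bigD1 (Ordinal ys)) //= eqxx mul1r.
rewrite nth_index -?index_mem //.
by rewrite big1 ?addr0 // => i; rewrite -val_eqE /= => /negPf ->; rewrite mul0r.
Qed.

Lemma span_ideal_sub (s : seq R) (J : ideal R) :
  {subset s <= J} -> {subset span_ideal s <= J}.
Proof.
move=> sJ a /asboolP[c ->]; apply: rpred_sum => i _.
by apply: (rpredZ (c i)); apply/sJ/mem_nth.
Qed.

Lemma span_ideal_nil a : (a \in span_ideal [::]) = (a == 0 :> R).
Proof.
apply/asboolP/eqP => [[c ->]|->]; first by rewrite big_ord0.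
by exists (fun=> 0); rewrite big_ord0.
Qed.

Fact ann_closed (c : R) : submod_closed (fun a : R^o => a * c == 0).
Proof.
split=> [|a u v]; rewrite !unfold_in; first by rewrite mul0r.
move=> /eqP uc /eqP vc; rewrite -[a *: u]/(a * u).
by rewrite mulrDl -mulrA uc vc mulr0 addr0.
Qed.

Definition ann c := ideal_of (ann_closed c).

Lemma annE c a : (a \in ann c) = (a * c == 0). Proof. by []. Qed.

Hypothesis noethR : noetherian R.

(** Dependent choice would give a strictly increasing chain of spans; its union is a finitely
    generated ideal, hence contained in one of the spans. *)
Lemma noetherian_greedy (P : seq R -> Prop) :
  P [::] -> (forall s, P s -> exists2 y, y \notin span_ideal s & P (rcons s y)) ->
  False.
Proof.
move=> P0 step.
pose rel (n : nat) (s s' : seq R) := exists2 y, y \notin span_ideal s & s' = rcons s y.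
have [n s Ps|S [_ SP]] := dependent_choice (inv := fun=> P) (rel := rel) P0.
  by have [y ys Psy] := step _ Ps; exists (rcons s y); split=> //; exists y.
have Smono i j : (i <= j)%N -> {subset S i <= S j}.
  elim: j => [|j IH]; first by rewrite leqn0 => /eqP ->.
  rewrite leq_eqVlt => /predU1P[-> //|/IH ij y /ij yj].
  by have [_ [z _ ->]] := SP j; rewrite mem_rcons inE yj orbT.
have span_mono i j : (i <= j)%N -> {subset span_ideal (S i) <= span_ideal (S j)}.
  by move=> ij; apply: span_ideal_sub => y /(Smono _ _ ij); apply: mem_span_ideal.
have Ucl : submod_closed (fun a : R^o => `[< exists n, a \in span_ideal (S n) >]).
  split=> [|a u v]; first by apply/asboolP; exists 0; apply: rpred0.
  move=> /asboolP[i ui] /asboolP[j vj]; apply/asboolP; exists (maxn i j).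
  apply: rpredD; first by apply: rpredZ; apply: span_mono ui; apply: leq_maxl.
  by apply: span_mono vj; apply: leq_maxr.
have [g gE] := noethR (ideal_of Ucl).
have [n gn] : exists n, {subset g <= span_ideal (S n)}.
  have : {subset g <= ideal_of Ucl} by move=> y /mem_span_ideal; rewrite -gE.
  elim: (g) => [|y g' IH] gU; first by exists 0.
  have [i gi] : exists i, {subset g' <= span_ideal (S i)}.
    by apply: IH => z zg; apply: gU; rewrite inE zg orbT.
  have /asboolP[j yj] := gU y (mem_head _ _).
  exists (maxn i j) => z; rewrite inE => /predU1P[->|/gi zi].
    by apply: span_mono yj; apply: leq_maxr.
  by apply: span_mono zi; apply: leq_maxl.
have [_ [y yn Sn]] := SP n.
have : y \in ideal_of Ucl.
  by apply/asboolP; exists n.+1; apply: mem_span_ideal; rewrite Sn mem_rcons mem_head.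
by rewrite gE => /(span_ideal_sub gn); rewrite (negPf yn).
Qed.

Lemma noetherian_max (Q : ideal R -> Prop) (K0 : ideal R) : Q K0 ->
  exists K, [/\ Q K, {subset K0 <= K} &
    forall K', Q K' -> {subset K <= K'} -> {subset K' <= K}].
Proof.
move=> QK0; apply: contrapT => noK.
(* The growing sequence stays inside some [K] with [Q K]; if [K] is not maximal, an element of a
   larger ideal extends it. *)
apply: (@noetherian_greedy
  (fun s => exists K, [/\ Q K, {subset K0 <= K} & {subset s <= K}])).
  by exists K0; split=> // y.
move=> s [K [QK K0K sK]]; apply: contrapT => noy; apply: noK; exists K; split=> //.
move=> K' QK' KK' y yK'; apply: contrapT => yK; apply: noy; exists y.
  by apply/negP => /(span_ideal_sub sK).
exists K'; split=> // [z /K0K/KK' //|z].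
by rewrite mem_rcons inE => /predU1P[-> //|/sK/KK'].
Qed.

(** Then [ann c] is an associated prime, maximal among annihilators of nonzero elements. *)
Definition max_ann (c : R) : Prop :=
  c != 0 /\ forall c', c' != 0 -> {subset ann c <= ann c'} -> {subset ann c' <= ann c}.

Lemma max_ann_exists c : c != 0 ->
  exists2 c', max_ann c' & {subset ann c <= ann c'}.
Proof.
move=> c0.
have [|K [[c' c'0 KE] cK Kmax]] :=
    @noetherian_max (fun K => exists2 c', c' != 0 & K =i ann c') (ann c).
  by exists c.
exists c' => [|a /cK]; last by rewrite KE.
split=> // d d0 c'd a; rewrite -KE; apply: Kmax; first by exists d.
by move=> b; rewrite KE; apply: c'd.
Qed.

(** If [a * b * c = 0] with [b * c] nonzero, then [a] lies in [ann (b * c)], which contains [ann c]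
    and so equals it by maximality. *)
Lemma max_ann_prime c a b : max_ann c -> a \notin ann c -> b \notin ann c ->
  a * b \notin ann c.
Proof.
move=> [c0 cmax] ac bc; apply/negP; rewrite annE -mulrA => abc.
have : a \in ann c; last by rewrite (negPf ac).
apply: (cmax (b * c)) => [|d|] //.
by rewrite !annE mulrCA => /eqP ->; rewrite mulr0.
Qed.

(** A product of elements [b], one for each [w], stays outside the prime [ann c]. *)
Lemma max_ann_prod c (s : seq R) : max_ann c ->
  (forall w, w \in s -> exists2 b, b \in ann w & b \notin ann c) ->
  exists2 b, b \notin ann c & forall w, w \in s -> b \in ann w.
Proof.
move=> cmax; elim: s => [_|w s IH sb].
  by exists 1; rewrite // annE mul1r; case: cmax.
have [b bw bc] := sb w (mem_head _ _).
have [|b' b'c b's] := IH; first by move=> v vs; apply: sb; rewrite inE vs orbT.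
exists (b * b'); first exact: max_ann_prime.
move=> v; rewrite inE => /predU1P[->|/b's b'v].
  by rewrite mulrC; apply: (rpredZ b').
exact: (rpredZ b).
Qed.

(** Finitely many elements [s] with maximal annihilator span all others. If [ann c] differed from
    every [ann w], a product outside [ann c] would kill [s], hence also [c], which lies in the
    span. *)
Lemma max_ann_finite : exists2 s : seq R, {in s, forall w, max_ann w} &
  forall c, max_ann c -> exists2 w, w \in s & ann c =i ann w.
Proof.
have [s smax sspan] : exists2 s : seq R, {in s, forall w, max_ann w} &
    forall c, max_ann c -> c \in span_ideal s.
  apply: contrapT => nos.
  apply: (@noetherian_greedy (fun s => {in s, forall w, max_ann w})).
    by [].
  move=> s smax; apply: contrapT => noy; apply: nos; exists s => // c cmax.
  apply: contrapT => /negP cs; apply: noy; exists c => // w.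
  by rewrite mem_rcons inE => /predU1P[-> //|/smax].
exists s => // c cmax; apply: contrapT => now.
have [|b bc bs] := max_ann_prod (s := s) cmax.
  move=> w ws; apply: contrapT => nob; apply: now; exists w => // a.
  have wc : {subset ann w <= ann c}.
    by move=> b bw; apply: contrapT => /negP bc; apply: nob; exists b.
  by apply/idP/idP; [apply: (smax w ws).2 => //; case: cmax | apply: wc].
have /(span_ideal_sub (J := ann b)) : {subset s <= ann b}.
  by move=> w /bs; rewrite !annE mulrC.
by move=> /(_ c (sspan c cmax)); rewrite annE mulrC -annE (negPf bc).
Qed.

(* Prime avoidance for the maximal annihilators, which are pairwise equal or
   incomparable. *)
Lemma max_ann_avoidance (J : ideal R) (s : seq R) : {in s, forall w, max_ann w} ->
  (forall w, w \in s -> exists2 y, y \in J & y \notin ann w) ->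
  exists2 y, y \in J & forall w, w \in s -> y \notin ann w.
Proof.
elim: s => [_ _|w s IH smax sJ]; first by exists 0; rewrite ?rpred0.
have wmax := smax w (mem_head _ _).
have [||y yJ ys] := IH.
- by move=> v vs; apply: smax; rewrite inE vs orbT.
- by move=> v vs; apply: sJ; rewrite inE vs orbT.
have [yw|yw] := boolP (y \in ann w); last first.
  by exists y => // v; rewrite inE => /predU1P[->|/ys].
have [j jJ jw] := sJ w (mem_head _ _).
(* [b] is to lie in every [ann v] but not in [ann w]. It exists because an inclusion of [ann v] in
   [ann w] would be an equality, putting [y] in [ann v]. *)
have [v vs|b bw bs] := max_ann_prod (s := s) wmax.
  apply: contrapT => nob; have /negP := ys v vs; apply.
  have [_ vmax] : max_ann v by apply: smax; rewrite inE vs orbT.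
  apply: vmax yw; first by case: wmax.
  by move=> b bv; apply: contrapT => /negP bw; apply: nob; exists b.
exists (y + b * j); first by rewrite rpredD //; apply: (rpredZ b).
move=> v; rewrite inE annE mulrDl => /predU1P[->|vs].
  by move: yw; rewrite annE => /eqP ->; rewrite add0r; apply: max_ann_prime.
have := bs v vs; rewrite annE mulrAC => /eqP ->.
by rewrite mul0r addr0; apply: ys.
Qed.

(** Zero divisors lie in finitely many maximal annihilators; by avoidance [J] lies in one [ann w],
    and [w] kills [J]. *)
Lemma zero_divisor_ideal (J : ideal R) :
  (forall y, y \in J -> exists2 c : R, c != 0 & y * c = 0) ->
  exists2 c : R, c != 0 & forall y, y \in J -> y * c = 0.
Proof.
move=> Jzd; have [s smax sE] := max_ann_finite.
apply: contrapT => noc.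
have [w ws|y yJ ys] := max_ann_avoidance (J := J) smax.
  apply: contrapT => noy; apply: noc; exists w => [|y yJ].
    by case: (smax w ws).
  apply/eqP; rewrite -annE; apply: contrapT => /negP yw.
  by apply: noy; exists y.
have [c c0 yc] := Jzd y yJ; have [c' c'max cc'] := max_ann_exists c0.
have [w ws c'w] := sE c' c'max.
by have := ys w ws; rewrite -c'w cc' // annE yc.
Qed.

End Noetherian.

(** * Regular sequences and depth *)

Section QuotientByIdeal.
Variables (R : comPzRingType) (J : ideal R).
Local Notation Q := (quot_ring J).
Local Notation pi := (pi_ring J).

Lemma pi_ring_surj (u : Q) : exists a, pi a = u.
Proof. by have [a ->] := pi_ringP u; exists a. Qed.

Lemma pi_ring_eq0 a : pi a = 0 <-> a \in J.
Proof. exact: (@pi_mod_eq0 R R^o J a). Qed.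

Lemma lreg_pi_ring y :
  GRing.lreg (pi y) <-> forall a : R, y * a \in J -> a \in J.
Proof.
split=> [yreg a /pi_ring_eq0 ya|yJ u v].
  by apply/pi_ring_eq0/yreg; rewrite mulr0 -rmorphM.
have [a ->] := pi_ringP u; have [b ->] := pi_ringP v.
rewrite -!rmorphM => /pi_ringE yab; apply/pi_ringE/yJ.
by rewrite mulrBr.
Qed.

Fact preim_ideal_closed (K : ideal Q) : submod_closed (fun a : R^o => pi a \in K).
Proof.
split=> [|a u v uK vK]; first by rewrite -[_ \in _]/(pi 0 \in K) rmorph0 (rpred0 K).
rewrite -[_ \in _]/(pi (a * u + v) \in K) rmorphD rmorphM.
exact: (GRing.submodClosedP K).2 (pi a) _ _ uK vK.
Qed.

Definition preim_ideal K : ideal R := ideal_of (preim_ideal_closed K).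

Lemma mem_preim_ideal (K : ideal Q) a : (a \in preim_ideal K) = (pi a \in K).
Proof. by []. Qed.

Lemma mem_quot_ideal (I : ideal R) a : {subset J <= I} ->
  (pi a \in quot_ideal J I) = (a \in I).
Proof.
move=> JI; apply/asboolP/idP => [[b bI /pi_ringE ba]|aI]; last by exists a.
have -> : a = (b : R^o) + (-1) *: ((b - a) : R^o) :> R^o.
  by rewrite scaleN1r opprB addrC subrK.
by apply: rpredD => //; apply/rpredZ/JI.
Qed.

Lemma quot_ideal_preim (I : ideal R) u : u \in quot_ideal J I ->
  exists2 a, a \in I & pi a = u.
Proof. by move=> /asboolP[a aI <-]; exists a. Qed.

Lemma quot_noetherian : noetherian R -> noetherian Q.
Proof.
move=> noethR K; have [s sE] := noethR (preim_ideal K).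
exists (map pi s) => u; have [a ->] := pi_ringP u.
apply/idP/idP; last first.
  apply: span_ideal_sub => _ /mapP[b bs ->].
  by rewrite -mem_preim_ideal sE mem_span_ideal.
rewrite -mem_preim_ideal sE -mem_preim_ideal; apply: span_ideal_sub => b bs.
by rewrite mem_preim_ideal mem_span_ideal ?map_f.
Qed.

(** The third isomorphism theorem. *)
Lemma quot_module_semi_iso (I : ideal R) : {subset J <= I} ->
  semi_iso pi (quot_module I) (quot_module (quot_ideal J I)).
Proof.
move=> JI; apply: (quot_semi_iso (f := fun a : R^o => pi_mod (quot_ideal J I) (pi a))).
- by move=> a u v; rewrite -linearP rmorphD rmorphM.
- by move=> w; have [u ->] := pi_modP w; have [a ->] := pi_ringP u; exists a.
- by move=> a; rewrite pi_mod_eq0 mem_quot_ideal.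
Qed.

End QuotientByIdeal.

Section QuotientByElement.
Variables (R : comPzRingType) (x : R).
Local Notation J := (span_ideal [:: x]).
Local Notation Q := (quot_ring J).
Local Notation pi := (pi_ring J).

Lemma span_ideal1P a : (a \in J) <-> exists b, a = x * b.
Proof.
split=> [/asboolP[c ->]|[b ->]].
  by exists (c 0%N); rewrite big_ord_recl big_ord0 addr0 mulrC.
by rewrite mulrC; apply/(rpredZ b)/mem_span_ideal/mem_head.
Qed.

Lemma span_ideal1_sub (I : ideal R) : x \in I -> {subset J <= I}.
Proof. by move=> xI; apply: span_ideal_sub => y; rewrite inE => /eqP ->. Qed.

Lemma mem_span_ideal_map (s : seq R) a :
  (pi a \in span_ideal (map pi s)) = (a \in span_ideal (x :: s)).
Proof.
have JS : {subset J <= span_ideal (x :: s)}.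
  exact/span_ideal1_sub/mem_span_ideal/mem_head.
apply/idP/idP.
  rewrite -(mem_quot_ideal _ JS); apply: span_ideal_sub => _ /mapP[b bs ->].
  by rewrite mem_quot_ideal // mem_span_ideal // inE bs orbT.
rewrite -mem_preim_ideal; apply: span_ideal_sub => b; rewrite mem_preim_ideal inE.
move=> /predU1P[->|bs]; last by rewrite mem_span_ideal ?map_f.
by rewrite (pi_ring_eq0 J x).2 ?(rpred0 (span_ideal _)) // mem_span_ideal ?mem_head.
Qed.

(** Dividing by [x] and then by the image of an initial segment of [s] is dividing by both at once,
    so the conditions match with indices shifted by one. *)
Lemma regular_seq_cons (s : seq R) :
  regular_seq (x :: s) <-> GRing.lreg x /\ regular_seq (map pi s).
Proof.
have one : (1 \in span_ideal (map pi s)) = (1 \in span_ideal (x :: s)).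
  by rewrite -(mem_span_ideal_map s 1) rmorph1.
have step i : (i < size s)%N ->
    GRing.lreg (pi_ring (span_ideal (take i (map pi s))) (map pi s)`_i) <->
    GRing.lreg (pi_ring (span_ideal (take i.+1 (x :: s))) (x :: s)`_i.+1).
  move=> si; rewrite !lreg_pi_ring (nth_map 0) //= -map_take.
  split=> [H a|H u].
    by rewrite -!mem_span_ideal_map rmorphM; apply: H.
  by have [a ->] := pi_ringP u; rewrite -rmorphM !mem_span_ideal_map; apply: H.
have lreg0 : GRing.lreg (pi_ring (span_ideal [::]) x) <-> GRing.lreg x.
  rewrite lreg_pi_ring; split=> [H|xreg a].
    move=> a b /eqP; rewrite -subr_eq0 -mulrBr -span_ideal_nil => /H.
    by rewrite span_ideal_nil subr_eq0 => /eqP.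
  by rewrite !span_ideal_nil => /eqP xa; apply/eqP/xreg; rewrite mulr0.
rewrite /regular_seq one size_map.
split=> [[ns reg]|[xreg [ns reg]]].
  split; first exact/lreg0/(reg 0).
  by split=> // i si; apply/step => //; apply: reg.
split=> // -[_|i si]; first exact/lreg0.
exact/step/reg.
Qed.

Lemma max_regular_seq_cons (I : ideal R) (s : seq R) : x \in I ->
  max_regular_seq I (x :: s) <->
  GRing.lreg x /\ max_regular_seq (quot_ideal J I) (map pi s).
Proof.
move=> xI; have JI := span_ideal1_sub xI.
split=> [[/regular_seq_cons[xreg sreg] sI smax]|[xreg [sreg sI smax]]].
  split=> //; split=> // [_ /mapP[a as_ ->]|_ /quot_ideal_preim[a aI <-]].
    by rewrite mem_quot_ideal // sI // inE as_ orbT.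
  rewrite -map_rcons => areg; apply: (smax a aI).
  exact/regular_seq_cons.
split=> [|y|y yI]; first exact/regular_seq_cons.
  rewrite inE => /predU1P[-> //|ys].
  by rewrite -(mem_quot_ideal _ JI) sI // map_f.
move=> /regular_seq_cons[_]; rewrite map_rcons.
by apply: smax; rewrite mem_quot_ideal.
Qed.

Lemma rees_quot (I : ideal R) n : GRing.lreg x -> x \in I ->
  semi_iso pi (Ext n.+1 (quot_module I) R^o)
    (Ext n (quot_module (quot_ideal J I)) Q^o).
Proof.
move=> xreg xI.
have [tau [tl ti ts]] := quot_module_semi_iso (span_ideal1_sub xI).
apply: (rees (x := x) _ _ _ _ tl ti ts) => //.
- exact: pi_ring_surj.
- by apply/pi_ring_eq0/span_ideal1P; exists 1; rewrite mulr1.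
- by move=> a /pi_ring_eq0/span_ideal1P.
Qed.

End QuotientByElement.

(** * Depth through the vanishing of Ext *)

Lemma max_regular_seq_exists (R : comPzRingType) (I : ideal R) :
  noetherian R -> 1 \notin I -> exists s, max_regular_seq I s.
Proof.
move=> noethR nI; apply: contrapT => noS.
apply: (noetherian_greedy noethR (P := fun s => regular_seq s /\ {subset s <= I})).
  split=> [|y //]; split=> [|i //].
  by apply: contra nI; rewrite span_ideal_nil => /eqP ->; apply: rpred0.
move=> s [sreg sI]; apply: contrapT => noy; apply: noS; exists s; split=> // y yI yreg.
apply: noy; exists y; last first.
  by split=> // z; rewrite mem_rcons inE => /predU1P[-> //|/sI].
(* The condition at index [size s] says that [y] is regular modulo the span of [s]; if [y] lay in
   that span, so would [1]. *)
have [ns /(_ (size s))] := yreg.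
rewrite size_rcons ltnSn nth_rcons ltnn eqxx -cats1 take_size_cat // => /(_ isT).
rewrite lreg_pi_ring => H; apply/negP => ys.
have := H 1; rewrite mulr1 => /(_ ys); apply/negP; apply: contra ns.
by apply: span_ideal_sub => z zs; rewrite mem_span_ideal // mem_rcons inE zs orbT.
Qed.

Lemma semi_iso_zero (A B : comPzRingType) (phi : {rmorphism A -> B})
    (V : lmodType A) (W : lmodType B) : semi_iso phi V W ->
  (forall v : V, v = 0) <-> (forall w : W, w = 0).
Proof.
move=> [f [fl fi fs]]; split=> [V0 w|W0 v].
  by have [v <-] := fs w; rewrite (V0 v) (linear_along0 fl).
by apply: fi; rewrite [LHS]W0 [RHS]W0.
Qed.

Lemma Ext0_zero (R : comPzRingType) (M : lmodType R) (x : R) :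
  GRing.lreg x -> (forall u : M, x *: u = 0) -> forall e : Ext 0 M R^o, e = 0.
Proof.
move=> xreg xM e; have [z ->] := pi_modP e; apply/pi_mod_eq0/coboundary0P => p.
have /res_exact0[q qE] : res_aug (std_resolution M) (x *: p) = 0.
  by rewrite linearZ; apply: xM.
apply: xreg; rewrite mulr0.
have zl : linear_along idfun (cocycle_fun z) := cocycle_linear z.
by have := linear_alongZ zl x p; rewrite -qE cocycle_diff.
Qed.

(** Multiplication by [c] induces a map from [R / I] to [R] sending 1 to [c]. *)
Lemma Ext0_quot_neq0 (R : comPzRingType) (I : ideal R) (c : R) : c != 0 ->
  (forall y, y \in I -> y * c = 0) ->
  ~ forall e : Ext 0 (quot_module I) R^o, e = 0.
Proof.
move=> c0 Ic E0; have /choice[r rE] := @pi_modP R R^o I.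
have rc a : r (pi_mod I a) * c = a * c.
  apply/eqP; rewrite -subr_eq0 -mulrBl; apply/eqP/Ic.
  by apply/pi_modE; rewrite -rE.
have gl : linear (fun u => r u * c : R^o).
  move=> a u v; have [a' ->] := pi_modP u; have [b' ->] := pi_modP v.
  by rewrite -linearP !rc mulrDl -[a *: a']/(a * a') -mulrA.
pose P := std_resolution (quot_module I).
have fl : linear (fun p : P 0 => r (res_aug P p) * c : R^o).
  by move=> a u v; rewrite linearP; apply: gl.
have [|z zE] := cocycle_exists fl.
  by move=> p; rewrite res_aug_diff -(raddf0 (pi_mod I)) rc mul0r.
have /pi_mod_eq0/coboundary0P z0 := E0 (pi_mod (coboundary (n := 0)) z).
have [p pE] := res_aug_surj P (pi_mod I 1).
have := z0 p; rewrite zE pE rc mul1r => cE.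
by rewrite cE eqxx in c0.
Qed.

Lemma Ext_max_regular_seq (R : comPzRingType) (I : ideal R) (s : seq R) :
  noetherian R -> 1 \notin I -> max_regular_seq I s ->
  (forall i, (i < size s)%N -> forall e : Ext i (quot_module I) R^o, e = 0) /\
  ~ forall e : Ext (size s) (quot_module I) R^o, e = 0.
Proof.
(* The induction is on a bound for the length, with the ring generalised, since the step passes to
   [quot_ring]. *)
have [n] := ubnP (size s); elim: n => // n IH in R I s *.
case: s => [|x s] /= sn noethR nI smax.
  split=> // ; have [_ _ nomax] := smax.
  (* By maximality of the empty sequence [[:: y]] is not regular; as [I] is proper, [y] must be a
     zero divisor. *)
  have Izd (y : R) : y \in I -> exists2 c : R, c != 0 & y * c = 0.
    move=> yI; apply: contrapT => noc; apply: (nomax y yI).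
    apply/regular_seq_cons; split.
      move=> a b /eqP; rewrite -subr_eq0 -mulrBr => /eqP yab.
      apply/eqP; rewrite -subr_eq0; apply: contrapT => /negP ab.
      by apply: noc; exists (a - b).
    split=> //; apply: contra nI => one; apply: (span_ideal1_sub yI).
    by rewrite -(mem_span_ideal_map y [::]) rmorph1.
  by have [c c0 Ic] := zero_divisor_ideal noethR Izd; apply: Ext0_quot_neq0 c0 Ic.
have [_ sI _] := smax; have xI := sI x (mem_head _ _).
have [xreg smax'] := (max_regular_seq_cons s xI).1 smax.
have nI' : 1 \notin quot_ideal (span_ideal [:: x]) I.
  by rewrite -(rmorph1 (pi_ring _)) mem_quot_ideal //; apply: span_ideal1_sub.
have [||lo hi] := IH _ _ (map (pi_ring (span_ideal [:: x])) s) _ _ nI' smax'.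
- by rewrite size_map.
- exact: quot_noetherian.
rewrite size_map in lo hi; split.
  case=> [_|i si].
    apply: (Ext0_zero xreg) => u; have [a ->] := pi_modP u.
    rewrite -linearZ; apply/pi_mod_eq0.
    by rewrite -[x *: a]/(x * a) mulrC; apply: (rpredZ a).
  exact/(semi_iso_zero (rees_quot i xreg xI))/lo.
by move=> /(semi_iso_zero (rees_quot _ xreg xI)).
Qed.

Lemma depthE (R : comPzRingType) (I : ideal R) (s : seq R) :
  noetherian R -> 1 \notin I -> max_regular_seq I s -> depth I = size s.
Proof.
move=> noethR nI smax.
have [s' s'max <-] : [set size s | s in max_regular_seq I]%classic (depth I).
  by apply: (xgetPex 0%N); exists (size s), s.
have [lo hi] := Ext_max_regular_seq noethR nI smax.
have [lo' hi'] := Ext_max_regular_seq noethR nI s'max.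
(* If the sizes differed, Ext in the smaller degree would be both zero and nonzero. *)
by have [/lo'/hi|/lo/hi'|] := ltngtP (size s) (size s').
Qed.

(** A maximal regular sequence of the quotient lifts to some [s], and [x :: s] is then maximal in
    [I]. *)
Lemma depth_quot (R : comPzRingType) (I : ideal R) (x : R) :
  noetherian R -> 1 \notin I -> x \in I -> GRing.lreg x ->
  depth I = (depth (quot_ideal (span_ideal [:: x]) I)).+1.
Proof.
move=> noethR nI xI xreg; have JI := span_ideal1_sub xI.
have noethQ := quot_noetherian (J := span_ideal [:: x]) noethR.
have nI' : 1 \notin quot_ideal (span_ideal [:: x]) I.
  by rewrite -(rmorph1 (pi_ring _)) mem_quot_ideal.
have [s' s'max] := max_regular_seq_exists noethQ nI'.
have [s sE] : exists s, map (pi_ring (span_ideal [:: x])) s = s'.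
  elim: (s') => [|u t [s <-]]; first by exists [::].
  by have [a ->] := pi_ringP u; exists (a :: s).
rewrite -sE in s'max; rewrite (depthE noethQ nI' s'max) size_map.
exact/(depthE (s := x :: s))/max_regular_seq_cons.
Qed.

(** By the maximal condition [I] lies in a maximal ideal, and [m] is the only one. *)
Lemma local_ring_sub (R : comPzRingType) (m I : ideal R) :
  noetherian R -> local_ring m -> 1 \notin I -> {subset I <= m}.
Proof.
move=> noethR [_ mP] nI.
have [K [nK IK Kmax]] := noetherian_max noethR (Q := fun K => 1 \notin K) nI.
have /mP Km : maximal_ideal K by split=> // K' KK' nK'; apply: Kmax.
by move=> a /IK; rewrite Km.
Qed.

Lemma quot_module_unit (R : comPzRingType) (I : ideal R) (u : quot_module I) :
  1 \in I -> u = 0.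
Proof.
move=> I1; have [a ->] := pi_modP u; apply/pi_mod_eq0.
by rewrite -[a]mulr1; apply: (rpredZ (a : R)).
Qed.

Theorem proposition3p8 (A : comPzRingType) (m I : ideal A) (t : nat) (x : A)
    (hnoeth : noetherian A) (hlocal : local_ring m)
    (hresidue : infinite_set [set: quot_ring m]%classic)
    (hdepth : depth I = t) (ht : (0 < t)%N)
    (hxI : x \in I) (hx : GRing.lreg x) :
  gen_type m I =
  gen_type (quot_ideal (span_ideal [:: x]) m)
           (quot_ideal (span_ideal [:: x]) I).
Proof.
rewrite /gen_type; have [I1|nI] := boolP (1 \in I).
  (* Both quotient modules are zero, hence both Ext modules, in whatever degrees; the zero map is
     then a semilinear isomorphism. *)
  apply: (length_semi_iso (phi := pi_ring (span_ideal [:: x]))).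
    exact: pi_ring_surj.
  exists (fun=> 0); split=> [a u v|u v _|w].
  - by rewrite scaler0 addr0.
  - rewrite (@Ext_of_zero _ _ _ _ _ u) ?(@Ext_of_zero _ _ _ _ _ v) // => ?;
      exact: quot_module_unit.
  - exists 0; rewrite (@Ext_of_zero _ _ _ _ _ w) // => ?; apply: quot_module_unit.
    by rewrite -(rmorph1 (pi_ring _)) mem_quot_ideal //; apply: span_ideal1_sub.
have Im := local_ring_sub hnoeth hlocal nI.
have [[nm _] _] := hlocal.
(* As [I] is proper, [x] lies in [m], so the depth drops by exactly one, which is the degree shift
   of Rees' isomorphism. *)
rewrite (depth_quot hnoeth nm (Im x hxI) hx).
exact/(length_semi_iso (@pi_ring_surj _ _))/rees_quot.
Qed.
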